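(* Let $\mathbf G$ be a split connected reductive group and $Q$ a Weyl-invariant integer-valued quadratic form on its cocharacter lattice $Y$. The following two statements are equivalent: (a) There exists a natural number $c\ge1$ (depending on $\mathbf G,Q$ only) such that $b_{W,n}=b_{W,n+c}$ for all $n\ge1$. (b) There exist $k\in\mathbf N$ and $f(T)\in\mathbf Z[T]$ such that $\mathcal P_W(T)=\dfrac{f(T)}{1-T^k}$; in particular $\mathcal P_W(T)\in\mathbf Q(T)$ in this case. Moreover, if $\mathbf G$ is an almost-simple group, then either of the statements (a) and (b) (and thus both) holds for $\mathcal P_W(T)$; the analogous assertion also holds for $\mathcal P_{\rm exc}(T)$ (i.e. with $b_{W,n}$ replaced by $|f_{\mathscr X}(Y_n^{\rm exc})|$ in (a), and $\mathcal P_W(T)$ replaced by $\mathcal P_{\rm exc}(T)$ in (b)).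
   Context: $(X,\Phi,\Delta;Y,\Phi^\vee,\Delta^\vee)$ is the root datum of $\mathbf G$, $W$ its Weyl group; $B_Q(x,y)=Q(x+y)-Q(x)-Q(y)$. For $n\ge1$: $Y_{Q,n}=\{y\in Y:B_Q(y,y')\in n\mathbf Z\ \forall y'\in Y\}$, $n_\alpha=n/\gcd(n,Q(\alpha^\vee))$, $Y_{Q,n}^{sc}$ is the lattice spanned by all $n_\alpha\alpha^\vee$, $\mathscr X_{Q,n}=Y/Y_{Q,n}$, $\mathscr X_{Q,n}^{sc}=Y/Y_{Q,n}^{sc}$, and $f_{\mathscr X}:Y\to\mathscr X_{Q,n}$ is the quotient map. $\rho=\frac12\sum_{\alpha>0}\alpha^\vee$, $y_\rho=y-\rho$; $W$ acts on $Y,\mathscr X_{Q,n},\mathscr X_{Q,n}^{sc}$ by the twisted action $w[y]=w(y-\rho)+\rho$, and fixed points are for this action. $b_{W,n}=|(\mathscr X_{Q,n})^W|$. For $\alpha\in\Delta$ let $W_\alpha=\{1,w_\alpha\}$ and $\phi_\alpha:(\mathscr X_{Q,n}^{sc})^{W_\alpha}\to(\mathscr X_{Q,n})^{W_\alpha}$ the natural map. $y\in Y$ is $\alpha$-normal if $f_{\mathscr X}(y)\in\mathrm{Im}(\phi_\alpha)$, and $\alpha$-special if $f_{\mathscr X}(y)\in(\mathscr X_{Q,n})^{W_\alpha}\setminus\mathrm{Im}(\phi_\alpha)$. $Y_n^{\rm exc}$ is the set of $y\in Y$ such that for every $\alpha\in\Delta$, either $y$ is $\alpha$-normal and $\langle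 y_\rho,\alpha\rangle=-n_\alpha$, or $y$ is $\alpha$-special and $\langle y_\rho,\alpha\rangle=-n_\alpha/2$. The Poincaré series are $\mathcal P_W(T)=\sum_{n\ge1}b_{W,n}T^n$ and $\mathcal P_{\rm exc}(T)=\sum_{n\ge1}|f_{\mathscr X}(Y_n^{\rm exc})|\,T^n$. *)

(* Defs.v *)
From mathcomp Require Import all_boot all_order all_algebra finmap.
From mathcomp Require Import boolp classical_sets functions cardinality.

Set Implicit Arguments.
Unset Strict Implicit.
Unset Printing Implicit Defensive.

Import GRing.Theory Num.Theory.
Local Open Scope ring_scope.
Local Open Scope classical_set_scope.

(* A Z-basis of Y and the dual basis of X are fixed, so that X = Y = Z^r and
   the perfect pairing <y, x> is the dot product; the same formula is its
   extension to Y (x) Q and X (x) Q. *)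
Definition pairing (R : pzRingType) (r : nat) (y x : 'rV[R]_r) : R :=
  \sum_(i < r) y 0 i * x 0 i.

(* Based reduced root datum (X, Phi, Delta; Y, Phi^vee, Delta^vee) of rank r.
   Split connected reductive groups over a field are classified by these. The
   function coroot is only meaningful on roots: Phi^vee and Delta^vee are the
   images of Phi and Delta. *)
Record root_datum (r : nat) := RootDatum {
  roots : {fset 'rV[int]_r};
  coroot : 'rV[int]_r -> 'rV[int]_r;
  simple_roots : {fset 'rV[int]_r};
  coroot_inj : {in roots &, injective coroot};
  pairing_coroot : {in roots, forall a, pairing (coroot a) a = 2};
  reflection_root : {in roots &, forall a b,
    b - pairing (coroot a) b *: a \in roots};
  reflection_coroot : {in roots &, forall a b, exists2 g, g \in roots &
    coroot b - pairing (coroot b) a *: coroot a = coroot g};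
  roots_reduced : {in roots &, forall a b (k m : int),
    m != 0 -> m *: b = k *: a -> b = a \/ b = - a};
  simple_sub : {subset simple_roots <= roots};
  simple_free : forall c : 'rV[int]_r -> int,
    \sum_(d <- simple_roots) c d *: d = 0 ->
    {in simple_roots, forall d, c d = 0};
  simple_base : {in roots, forall a, exists c : 'rV[int]_r -> nat,
    a = \sum_(d <- simple_roots) d *+ c d \/
    a = - \sum_(d <- simple_roots) d *+ c d}
}.

Section RootDatum.
Variables (r : nat) (D : root_datum r).

Definition positive_root (a : 'rV[int]_r) : Prop :=
  a \in roots D /\
  exists c : 'rV[int]_r -> nat, a = \sum_(d <- simple_roots D) d *+ c d.

Definition toQ (y : 'rV[int]_r) : 'rV[rat]_r := map_mx intr y.

Definition rho : 'rV[rat]_r :=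
  2^-1 *: \sum_(a <- roots D | `[< positive_root a >]) toQ (coroot D a).

(* y *m reflection a = y - <y, a> a^vee. *)
Definition reflection (a : 'rV[int]_r) : 'M[int]_r :=
  1%:M - a^T *m coroot D a.

(* Reflections are involutions, so their products form a group; it acts on the
   row vectors of Y by right multiplication. *)
Definition weyl_group : set 'M[int]_r :=
  [set w | exists2 s : seq 'rV[int]_r, {subset s <= roots D} &
     w = \big[mulmx/1%:M]_(a <- s) reflection a].

Definition weyl_subgroup (a : 'rV[int]_r) : set 'M[int]_r :=
  [set 1%:M; reflection a].

Definition twisted (w : 'M[int]_r) (v : 'rV[rat]_r) : 'rV[rat]_r :=
  (v - rho) *m map_mx intr w + rho.

(* The twisted action is defined on Y (x) Q, where rho lives; it preserves Y,
   and the image w[C] of a subset C of Y is read back in Y. *)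
Definition twisted_set (w : 'M[int]_r) (C : set 'rV[int]_r) :
    set 'rV[int]_r :=
  toQ @^-1` (twisted w @` (toQ @` C)).

Definition semisimple : Prop :=
  forall x : 'rV[int]_r, exists2 m : int, m != 0 &
    exists c : 'rV[int]_r -> int, m *: x = \sum_(a <- roots D) c a *: a.

Definition irreducible_roots : Prop :=
  roots D != fset0 /\
  forall A B : {fset 'rV[int]_r}, (A `|` B)%fset = roots D ->
    A != fset0 -> B != fset0 ->
    ~ {in A & B, forall a b, pairing (coroot D a) b = 0}.

Definition almost_simple : Prop := semisimple /\ irreducible_roots.

End RootDatum.

Section Cosets.
Variable r : nat.

Definition coset_mod (L : set 'rV[int]_r) (y : 'rV[int]_r) : set 'rV[int]_r :=
  [set z | L (z - y)].

Definition quotient_set (L : set 'rV[int]_r) : set (set 'rV[int]_r) :=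
  range (coset_mod L).

Definition twisted_fixed (D : root_datum r) (G : set 'M[int]_r)
    (L : set 'rV[int]_r) : set (set 'rV[int]_r) :=
  [set C | quotient_set L C /\ forall w, G w -> twisted_set D w C = C].

(* For L' contained in L, the natural map Y/L' -> Y/L. *)
Definition natural_map (L : set 'rV[int]_r) (C : set 'rV[int]_r) :
    set 'rV[int]_r :=
  [set z | exists2 y, C y & L (z - y)].

End Cosets.

Section QuadraticForm.
Variables (r : nat) (D : root_datum r) (Q : 'rV[int]_r -> int).

Definition polar (x y : 'rV[int]_r) : int := Q (x + y) - Q x - Q y.

Definition quadratic_form : Prop :=
  (forall (k : int) y, Q (k *: y) = k ^+ 2 * Q y) /\
  (forall x x' y, polar (x + x') y = polar x y + polar x' y).

Definition weyl_invariant : Prop :=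
  forall w y, weyl_group D w -> Q (y *m w) = Q y.

Variable n : nat.

Definition Y_Qn : set 'rV[int]_r :=
  [set y | forall y', (n%:Z %| polar y y')%Z].

Definition n_ (a : 'rV[int]_r) : nat :=
  (n %/ gcdn n `|Q (coroot D a)|%N)%N.

Definition Ysc_Qn : set 'rV[int]_r :=
  [set y | exists c : 'rV[int]_r -> int,
     y = \sum_(a <- roots D) c a *: (coroot D a *+ n_ a)].

Definition b_W : nat :=
  #|` fset_set (twisted_fixed D (weyl_group D) Y_Qn)|.

Definition im_phi (a : 'rV[int]_r) : set (set 'rV[int]_r) :=
  natural_map Y_Qn @` twisted_fixed D (weyl_subgroup D a) Ysc_Qn.

Definition alpha_normal (a y : 'rV[int]_r) : Prop :=
  im_phi a (coset_mod Y_Qn y).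

Definition alpha_special (a y : 'rV[int]_r) : Prop :=
  (twisted_fixed D (weyl_subgroup D a) Y_Qn `\` im_phi a) (coset_mod Y_Qn y).

Definition Y_exc : set 'rV[int]_r :=
  [set y | forall a, a \in simple_roots D ->
     (alpha_normal a y /\ pairing (toQ y - rho D) (toQ a) = - (n_ a)%:R) \/
     (alpha_special a y /\
      pairing (toQ y - rho D) (toQ a) = - ((n_ a)%:R / 2))].

Definition b_exc : nat := #|` fset_set (coset_mod Y_Qn @` Y_exc)|.

End QuadraticForm.

Section PowerSeries.

(* A formal power series over R is its sequence of coefficients; a polynomial p
   is the power series nth 0 p. *)
Definition fps_mul (R : pzRingType) (p s : nat -> R) (n : nat) : R :=
  \sum_(i < n.+1) p i * s (n - i)%N.

(* s = f / g as power series, for g a non-zero-divisor. *)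
Definition fps_quotient (R : nzRingType) (s : nat -> R) (f g : {poly R}) :
    Prop :=
  fps_mul (nth 0 g) s =1 nth 0 f.

Definition poincare_series (b : nat -> nat) (n : nat) : int :=
  if n is 0 then 0 else (b n)%:Z.

Definition purely_periodic (b : nat -> nat) : Prop :=
  exists2 c : nat, (1 <= c)%N & forall n : nat, (1 <= n)%N -> b n = b (n + c)%N.

Definition cyclic_denominator (s : nat -> int) : Prop :=
  exists2 k : nat, (1 <= k)%N &
    exists f : {poly int}, fps_quotient s f (1 - 'X^k).

Definition rational_series (s : nat -> int) : Prop :=
  exists f g : {poly rat}, g != 0 /\ fps_quotient (fun n => (s n)%:~R) f g.

End PowerSeries.

(* Main.v *)
From mathcomp Require Import all_boot all_order all_algebra finmap.
From mathcomp Require Import boolp classical_sets functions cardinality.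
From mathcomp Require Import ring lra zify.
Require Import Defs.

(** Let B be the polar form of Q. Both coefficients count classes modulo Y_Qn of a set
    P(n) of points y cut out by conditions on the numbers <y - rho, a>. The class of y
    is fixed by W when <y - rho, a> a^vee lies in Y_Qn for every root a
    ([weyl_group_fixedP]), and y is exceptional when, for every simple root a,
    <y - rho, a> is - n_a, or is - n_a / 2 with (n_a / 2) a^vee in Y_Qn but not in
    Ysc_Qn ([Y_excP]).

    Invariance of Q gives B(a^vee, y) = Q(a^vee) <y, a> ([polar_coroot]), so these
    conditions are homogeneous in n up to an integrality constraint. Hence there is a
    c such that, for m congruent to n modulo c, some map F from P(n) to P(m) rescales
    the relevant pairings from n to m ([weyl_solutions_transfer], [Y_exc_transfer]).
    It is built from a rational pseudo-inverse of the matrix of these pairings, and c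
    clears the denominators. For x and y in P(n), the vector n (F x - F y) - m (x - y)
    then lies in the subgroup K of Y on which the relevant linear forms vanish.

    There are two cases. If B(z, .) = 0 for all z in K, then F is injective on classes;
    as n and m play symmetric roles, the count is purely periodic with period c
    ([purely_periodic_class_count]). Otherwise some z in K has u = B(z, y0) != 0. The
    set P(n) is stable under translation by z, and the multiples of z give at least
    n / |u| classes, rounded down, as soon as P(n) is nonempty, while nonemptiness of
    P(n) depends only on n modulo c. Then an eventually periodic count, being bounded,
    is identically 0. A denominator 1 - T^k means eventual periodicity, so in both
    cases (b) implies (a); the converse is immediate.

    For a semisimple datum K always lies in the radical of B
    ([semisimple_weighted_kernel], [semisimple_simple_kernel]). This rests on the fact
    that a combination of roots orthogonal to all coroots vanishes
    ([root_span_orthogonal]), proved with the invariant form sum_x <., x>^2 over the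
    roots x. *)

Set Implicit Arguments.
Unset Strict Implicit.
Unset Printing Implicit Defensive.

Import Order.TTheory GRing.Theory Num.Theory.
Local Open Scope ring_scope.
Local Open Scope classical_set_scope.

(** * The pairing and its rational extension *)

Section Pairing.
Variables (R : comPzRingType) (r : nat).
Implicit Types x y z : 'rV[R]_r.

Lemma pairingC x y : pairing x y = pairing y x.
Proof. by apply: eq_bigr => i _; rewrite mulrC. Qed.

Lemma pairingDl x y z : pairing (x + y) z = pairing x z + pairing y z.
Proof. by rewrite /pairing -big_split; apply: eq_bigr => i _; rewrite mxE mulrDl. Qed.

Lemma pairingZl k x z : pairing (k *: x) z = k * pairing x z.
Proof. by rewrite /pairing big_distrr; apply: eq_bigr => i _; rewrite mxE /= mulrA. Qed.

Lemma pairingNl x z : pairing (- x) z = - pairing x z.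
Proof. by rewrite -scaleN1r pairingZl mulN1r. Qed.

Lemma pairingBl x y z : pairing (x - y) z = pairing x z - pairing y z.
Proof. by rewrite pairingDl pairingNl. Qed.

Lemma pairing0l z : pairing 0 z = 0.
Proof. by rewrite -(scale0r 0) pairingZl mul0r. Qed.

Lemma pairing_suml (I : Type) (s : seq I) (P : pred I) (F : I -> 'rV[R]_r) z :
  pairing (\sum_(i <- s | P i) F i) z = \sum_(i <- s | P i) pairing (F i) z.
Proof.
apply: (big_ind2 (fun x k => pairing x z = k)) => //; first exact: pairing0l.
by move=> ? ? ? ? <- <-; rewrite pairingDl.
Qed.

Lemma mulmx_tr_pairing x y z : x *m y^T *m z = pairing x y *: z.
Proof.
apply/rowP => i; rewrite !mxE big_ord1 !mxE; congr (_ * _).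
by apply: eq_bigr => j _; rewrite mxE.
Qed.

Lemma pairing_delta x i : pairing x (delta_mx 0 i) = x 0 i.
Proof.
rewrite /pairing (bigD1 i) //= big1 => [|j ji]; first by rewrite mxE !eqxx mulr1 addr0.
by rewrite mxE (negbTE ji) andbF mulr0.
Qed.

End Pairing.

Section ToQ.
Variable r : nat.
Implicit Types x y : 'rV[int]_r.

Lemma toQD x y : toQ (x + y) = toQ x + toQ y. Proof. exact: map_mxD. Qed.
Lemma toQN x : toQ (- x) = - toQ x. Proof. exact: map_mxN. Qed.
Lemma toQB x y : toQ (x - y) = toQ x - toQ y. Proof. exact: map_mxB. Qed.
Lemma toQ0 : toQ (0 : 'rV[int]_r) = 0. Proof. exact: map_mx0. Qed.
Lemma toQZ k x : toQ (k *: x) = k%:~R *: toQ x. Proof. exact: map_mxZ. Qed.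

Lemma toQMn x n : toQ (x *+ n) = n%:R *: toQ x.
Proof. by rewrite -scaler_nat toQZ rmorph_nat. Qed.

Lemma toQ_sum (I : Type) (s : seq I) (P : pred I) (F : I -> 'rV[int]_r) :
  toQ (\sum_(i <- s | P i) F i) = \sum_(i <- s | P i) toQ (F i).
Proof. exact: (big_morph _ toQD toQ0). Qed.

Lemma toQ_inj : injective (@toQ r).
Proof.
by move=> x y /rowP e; apply/rowP => i; move: (e i); rewrite !mxE => /intr_inj.
Qed.

Lemma pairing_toQ x y : pairing (toQ x) (toQ y) = (pairing x y)%:~R.
Proof. by rewrite /pairing rmorph_sum; apply: eq_bigr => i _; rewrite !mxE rmorphM. Qed.

End ToQ.

Lemma common_denominator (m n : nat) (P : 'M[rat]_(m, n)) :
  exists2 c : nat, (0 < c)%N & exists P0 : 'M[int]_(m, n), c%:R *: P = map_mx intr P0.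
Proof.
pose d (p : 'I_m * 'I_n) := `|denq (P p.1 p.2)|%N.
exists (\prod_p d p)%N; first by apply: prodn_gt0 => p; rewrite absz_gt0 denq_eq0.
exists (\matrix_(i, j) ((\prod_(p | p != (i, j)) d p)%N%:Z * numq (P i j))).
apply/matrixP => i j; rewrite !mxE (bigD1 (i, j)) //= mulnC natrM -mulrA rmorphM /=.
congr (_ * _); rewrite /d /= pmulrn absz_denq.
by rewrite -{2}(divq_num_den (P i j)) mulrC divfK // intr_eq0 denq_eq0.
Qed.

(** * Power series with a cyclic denominator *)

(** Multiplying by 1 - T^k takes differences of coefficients at distance k, so a
    denominator 1 - T^k expresses k-periodicity up to finitely many terms. *)
Lemma fps_mul_1subXn (s : nat -> int) k i : (0 < k)%N ->
  fps_mul (nth 0 (1 - 'X^k : {poly int})) s i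
    = s i - (if (k <= i)%N then s (i - k)%N else 0).
Proof.
move=> k0; rewrite /fps_mul big_ord_recl.
have E0 : (1 - 'X^k : {poly int})`_0 = 1.
  by rewrite coefB coef1 coefXn (ltn_eqF k0) subr0.
rewrite E0 mul1r subn0; congr (_ + _).
have E (j : 'I_i) : (1 - 'X^k : {poly int})`_(lift ord0 j) = - (j.+1 == k)%:R.
  by rewrite coefB coef1 coefXn /= sub0r.
under eq_bigr => j _ do rewrite E mulNr.
rewrite sumrN; congr (- _).
case: leqP => ki.
  have h : (k.-1 < i)%N by rewrite prednK.
  rewrite (bigD1 (Ordinal h)) //= /bump leq0n add1n prednK // eqxx mul1r.
  rewrite big1 ?addr0 // => j jk.
  case: eqP => [e|_]; last by rewrite mul0r.
  by case/eqP: jk; apply/val_inj; rewrite /= -e.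
rewrite big1 // => j _; case: eqP => [e|_]; last by rewrite mul0r.
by have := ltn_ord j; rewrite -ltnS e ltnS leqNgt ki.
Qed.

(** The index is kept above the degree of the numerator and above 0, where the
    series has a conventional coefficient 0 instead of [b 0]. *)
Lemma cyclic_denominator_eventually (b : nat -> nat) :
  cyclic_denominator (poincare_series b) ->
  exists2 k : nat, (0 < k)%N &
    exists N : nat, forall n, (N <= n)%N -> b (n + k)%N = b n.
Proof.
move=> [k k0 [f fE]]; exists k => //; exists (size f).+1 => n Nn.
have := fE (n + k)%N; rewrite fps_mul_1subXn // leq_addl addnK.
rewrite nth_default; last by rewrite (leq_trans (ltnW Nn)) ?leq_addr.
case: n Nn => // n Nn; rewrite /poincare_series addSn => /eqP.
by rewrite subr_eq0 => /eqP [].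
Qed.

(** The numerator is cut at degree k, not k - 1: its coefficient at k is [b k],
    because the constant coefficient of the series is 0 and not [b k]. *)
Lemma purely_periodic_cyclic_denominator (b : nat -> nat) :
  purely_periodic b -> cyclic_denominator (poincare_series b).
Proof.
move=> [k k0 per]; exists k => //.
exists (\poly_(i < k.+1) poincare_series b i) => i.
rewrite fps_mul_1subXn // coef_poly ltnS.
case: (ltngtP k i) => [ki|_|<-]; last 2 first.
- by rewrite subr0.
- by rewrite subnn subr0.
rewrite -{1}(subnK (ltnW ki)).
have : (0 < i - k)%N by rewrite subn_gt0.
by case: (i - k)%N => // j _; rewrite /poincare_series addSn -addSn -per // subrr.
Qed.

Lemma cyclic_denominator_rational (s : nat -> int) :
  cyclic_denominator s -> rational_series s.
Proof.
move=> [k k0 [f fE]].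
exists (map_poly intr f), (map_poly intr (1 - 'X^k)); split.
  have den0 : (1 - 'X^k : {poly int}) != 0.
    by rewrite -size_poly_eq0 -opprB size_polyN size_XnsubC.
  by rewrite map_poly_eq0_id0 ?intr_eq0 ?lead_coef_eq0.
move=> n; rewrite coef_map /= -fE /fps_mul rmorph_sum; apply: eq_bigr => i _.
by rewrite coef_map rmorphM.
Qed.

(** The hypotheses make nonvanishing propagate along n, n + c, n + 2c and so on, and
    force linear growth along the way. An eventually periodic sequence is bounded, so
    with these properties it vanishes at all positive integers. *)
Lemma eventually_periodic_purely (b : nat -> nat) (c C : nat) :
  (0 < c)%N ->
  (forall n, (0 < n)%N -> (0 < b n)%N -> (0 < b (n + c))%N) ->
  (forall n, (0 < n)%N -> (0 < b n)%N -> (n <= C * b n)%N) ->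
  cyclic_denominator (poincare_series b) -> purely_periodic b.
Proof.
move=> c0 supp growth /cyclic_denominator_eventually [k k0 [N per]].
have bounded n : (N <= n)%N -> (b n <= \max_(i < N + k) b i)%N.
  elim/ltn_ind: n => n IH Nn; case: (ltnP n (N + k)%N) => [h|h].
    exact: (@leq_bigmax _ (fun i : 'I_(N + k) => b i) (Ordinal h)).
  by rewrite -(subnK (leq_trans (leq_addl N k) h)) per ?IH //; lia.
have b0 n : (0 < n)%N -> b n = 0%N.
  move=> n0; apply/eqP; rewrite -leqn0 leqNgt; apply/negP => bn.
  set K := (\max_(i < N + k) b i)%N in bounded.
  have pos j : (0 < b (n + j * c))%N.
    elim: j => [|j IH]; first by rewrite addn0.
    by rewrite mulSn [(c + _)%N]addnC addnA; apply: supp => //; lia.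
  (* This j puts n + j c both in the periodic range and past the growth bound C K. *)
  pose j := (N + C * K)%N.
  have h1 := growth (n + j * c)%N ltac:(lia) (pos j).
  have h2 : (b (n + j * c) <= K)%N by apply: bounded; rewrite /j; nia.
  have : (n + j * c <= C * K)%N by rewrite (leq_trans h1) // leq_mul2l h2 orbT.
  rewrite /j; nia.
by exists 1%N => // n n0; rewrite !b0 //; lia.
Qed.

(** * Invariant forms on roots and coroots *)

Section Reflections.
Variable r : nat.
Implicit Types (a b x y u : 'rV[int]_r).

(** The reflection [t x = x - <b, x> a] permutes [s] and negates [<b, x>]. Summing
    [<b, x> x] over [t x] instead of [x] therefore gives the opposite of the sum,
    up to a multiple of [a]. With the roots for [s], the sum is the image of [b] under
    the invariant form [sum_x <., x>^2], which thus sends a coroot to a positive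
    multiple of its root. *)
Lemma reflection_sum (s : seq 'rV[int]_r) a b : uniq s -> pairing b a = 2 ->
  {in s, forall x, x - pairing b x *: a \in s} ->
  2 *: \sum_(x <- s) pairing b x *: x = (\sum_(x <- s) pairing b x ^+ 2) *: a.
Proof.
move=> us ba2 stab; pose t x := x - pairing b x *: a.
have bt x : pairing b (t x) = - pairing b x.
  rewrite pairingC pairingBl pairingZl !(pairingC _ b) ba2; ring.
have tt x : t (t x) = x by rewrite /t bt scaleNr opprK subrK.
have st : perm_eq s (map t s).
  apply: uniq_perm => //; first by rewrite (map_inj_uniq (can_inj tt)).
  move=> x; apply/idP/mapP => [xs|[y ys ->]]; last exact: stab.
  by exists (t x); rewrite ?tt //; exact: stab.
set S := \sum_(x <- s) _.
have SE : S = - S + (\sum_(x <- s) pairing b x ^+ 2) *: a.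
  rewrite {1}/S (perm_big _ st) big_map scaler_suml -sumrN -big_split.
  apply: eq_bigr => x _; rewrite bt /t /= scaleNr scalerBr scalerA opprB addrC.
  by rewrite expr2.
by rewrite scaler_nat mulr2n {1}SE addrAC addNr add0r.
Qed.

(** Let G be the positive semidefinite form [sum_j <., a_j>^2]. By the second
    hypothesis the span of the [a_i] is the image under G of the span of the [b_i], so
    the given combination is [G w] with [w] in the span of the [b_i]. Being orthogonal
    to the [b_i] it is orthogonal to [w], hence [G(w, w) = 0]; as G is a sum of squares,
    [G w = 0]. *)
Lemma span_orthogonal_eq0 (T : eqType) (s : seq T) (a b : T -> 'rV[rat]_r)
    (N c : T -> rat) :
  {in s, forall i, N i != 0} ->
  {in s, forall i, N i *: a i = \sum_(j <- s) pairing (b i) (a j) *: a j} ->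
  {in s, forall i, pairing (b i) (\sum_(j <- s) c j *: a j) = 0} ->
  \sum_(j <- s) c j *: a j = 0.
Proof.
move=> N0 Na orth; set u := \sum_(j <- s) _ in orth *.
pose w := \sum_(i <- s) (c i / N i) *: b i.
have uE : u = \sum_(j <- s) pairing w (a j) *: a j.
  transitivity (\sum_(i <- s) \sum_(j <- s) (c i / N i * pairing (b i) (a j)) *: a j).
    apply: eq_big_seq => i si.
    have -> : c i *: a i = (c i / N i) *: (N i *: a i) by rewrite scalerA divfK // N0.
    by rewrite Na // scaler_sumr; apply: eq_bigr => j _; rewrite scalerA.
  rewrite exchange_big; apply: eq_bigr => j _ /=.
  rewrite -scaler_suml /w pairing_suml; congr (_ *: _).
  by apply: eq_bigr => i _; rewrite pairingZl.
have wu0 : pairing w u = 0.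
  rewrite /w pairing_suml big_seq big1 // => i si.
  by rewrite pairingZl orth // mulr0.
have sq : \sum_(j <- s) pairing w (a j) ^+ 2 = 0.
  rewrite -[RHS]wu0 [in RHS]uE [RHS]pairingC pairing_suml; apply: eq_bigr => j _.
  by rewrite pairingZl [in RHS]pairingC expr2.
rewrite uE big_seq big1 // => j sj; suff -> : pairing w (a j) = 0 by rewrite scale0r.
move/eqP: sq; rewrite psumr_eq0; last by move=> *; exact: sqr_ge0.
by move/allP => /(_ _ sj) /=; rewrite sqrf_eq0 => /eqP.
Qed.

Lemma pairing_sq_gt0 (s : seq 'rV[int]_r) a b : pairing b a = 2 -> a \in s ->
  0 < \sum_(x <- s) pairing b x ^+ 2.
Proof.
move=> ba2 sa; rewrite (big_rem a sa) /= ba2.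
by rewrite ltr_pwDl // sumr_ge0 // => x _; exact: sqr_ge0.
Qed.
End Reflections.

Section RootData.
Variables (r : nat) (D : root_datum r).
Implicit Types a b g y : 'rV[int]_r.

Definition root_norm a : int := \sum_(x <- roots D) pairing (coroot D a) x ^+ 2.
Definition coroot_norm a : int :=
  \sum_(x <- map (coroot D) (roots D)) pairing a x ^+ 2.

Lemma root_norm_gt0 a : a \in roots D -> 0 < root_norm a.
Proof. by move=> Ra; exact: pairing_sq_gt0 (pairing_coroot Ra) Ra. Qed.

Lemma root_normE a : a \in roots D ->
  2 *: \sum_(x <- roots D) pairing (coroot D a) x *: x = root_norm a *: a.
Proof.
move=> Ra; apply: reflection_sum; [exact: fset_uniq|exact: pairing_coroot|].
by move=> x Rx; exact: reflection_root.
Qed.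

Lemma coroot_norm_gt0 a : a \in roots D -> 0 < coroot_norm a.
Proof.
move=> Ra; apply: (@pairing_sq_gt0 _ _ (coroot D a)); last exact: map_f.
by rewrite pairingC pairing_coroot.
Qed.

Lemma coroot_normE a : a \in roots D ->
  2 *: \sum_(x <- roots D) pairing a (coroot D x) *: coroot D x
    = coroot_norm a *: coroot D a.
Proof.
move=> Ra; rewrite -(big_map (coroot D) predT (fun x => pairing a x *: x)).
apply: reflection_sum.
- by rewrite map_inj_in_uniq ?fset_uniq //; exact: coroot_inj.
- by rewrite pairingC pairing_coroot.
- move=> _ /mapP [x Rx ->]; rewrite pairingC; have [g Rg ->] := reflection_coroot Ra Rx.
  exact: map_f.
Qed.

Lemma root_span_orthogonal (c : 'rV[int]_r -> rat) :
  {in roots D, forall a,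
     pairing (toQ (coroot D a)) (\sum_(b <- roots D) c b *: toQ b) = 0} ->
  \sum_(b <- roots D) c b *: toQ b = 0.
Proof.
apply: (@span_orthogonal_eq0 _ _ _ _ _ (fun a => (root_norm a)%:~R / 2)) => a Ra.
  by rewrite mulf_neq0 // intr_eq0 gt_eqF // root_norm_gt0.
rewrite mulrC -scalerA -toQZ -root_normE // toQZ scalerA mulVf // scale1r.
by rewrite toQ_sum; apply: eq_bigr => b _; rewrite toQZ pairing_toQ.
Qed.

Lemma coroot_span_orthogonal (c : 'rV[int]_r -> rat) :
  {in roots D, forall a,
     pairing (\sum_(b <- roots D) c b *: toQ (coroot D b)) (toQ a) = 0} ->
  \sum_(b <- roots D) c b *: toQ (coroot D b) = 0.
Proof.
move=> orth.
apply: (@span_orthogonal_eq0 _ _ _ (fun b => toQ (coroot D b)) (@toQ r)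
  (fun a => (coroot_norm a)%:~R / 2) c) => a Ra.
- by rewrite mulf_neq0 // intr_eq0 gt_eqF // coroot_norm_gt0.
- rewrite mulrC -scalerA -toQZ -coroot_normE // toQZ scalerA mulVf // scale1r.
  by rewrite toQ_sum; apply: eq_bigr => b _; rewrite toQZ pairing_toQ.
- by rewrite pairingC orth.
Qed.

(** Both pairings are positive multiples of the value at the two coroots of the
    symmetric form [sum_x <., x>^2]. *)
Lemma pairing_coroot_sym0 a b : a \in roots D -> b \in roots D ->
  pairing (coroot D a) b = 0 -> pairing (coroot D b) a = 0.
Proof.
move=> Ra Rb ab0.
have E g h : g \in roots D -> h \in roots D ->
    root_norm h * pairing (coroot D g) h
      = 2 * \sum_(x <- roots D) pairing (coroot D g) x * pairing (coroot D h) x.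
  move=> Rg Rh; rewrite pairingC -pairingZl -root_normE // pairingZl pairing_suml.
  congr (_ * _); apply: eq_bigr => x _.
  by rewrite pairingZl mulrC (pairingC x).
have h : root_norm a * pairing (coroot D b) a = root_norm b * pairing (coroot D a) b.
  rewrite !E //; congr (_ * _); apply: eq_bigr => x _; exact: mulrC.
move/eqP: h; rewrite ab0 mulr0 mulf_eq0 gt_eqF ?root_norm_gt0 //=.
by move/eqP.
Qed.

Lemma reflection_mul a y :
  y *m reflection D a = y - pairing y a *: coroot D a.
Proof. by rewrite mulmxBr mulmx1 mulmxA mulmx_tr_pairing. Qed.

Lemma reflectionK a : a \in roots D -> reflection D a *m reflection D a = 1%:M.
Proof.
move=> Ra; apply/row_matrixP => i; rewrite !rowE mulmxA !reflection_mul mulmx1.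
set p := pairing _ a; rewrite pairingBl pairingZl pairing_coroot // -/p.
have -> : p - p * 2 = - p by ring.
by rewrite scaleNr opprK subrK.
Qed.

End RootData.

(** * Cosets fixed by the twisted action *)

Section Lattices.
Variable r : nat.
Implicit Types (L : set 'rV[int]_r) (x y z : 'rV[int]_r) (w : 'M[int]_r).

Definition lattice L := L 0 /\ forall x y, L x -> L y -> L (x - y).

Definition stable L w := forall x, L x -> L (x *m w).

Lemma latticeN L x : lattice L -> L x -> L (- x).
Proof. by move=> [L0 LB] Lx; rewrite -sub0r; exact: LB. Qed.

Lemma latticeD L x y : lattice L -> L x -> L y -> L (x + y).
Proof. by move=> hL Lx Ly; rewrite -[y]opprK; apply: hL.2 => //; exact: latticeN. Qed.

Lemma latticeZ L k x : lattice L -> L x -> L (k *: x).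
Proof.
move=> hL Lx; elim/int_ind: k => [|n IH|n IH].
- by rewrite scale0r; exact: hL.1.
- by rewrite intS scalerDl scale1r; exact: latticeD.
- by rewrite intS opprD scalerDl scaleN1r addrC; exact: hL.2.
Qed.

Lemma lattice_sum (I : eqType) (s : seq I) (F : I -> 'rV[int]_r) L : lattice L ->
  {in s, forall i, L (F i)} -> L (\sum_(i <- s) F i).
Proof.
move=> hL hF; rewrite big_seq; apply: big_ind => //; first exact: hL.1.
by move=> *; exact: latticeD.
Qed.

Lemma coset_mod_eqP L x y : lattice L -> coset_mod L x = coset_mod L y <-> L (x - y).
Proof.
move=> hL; split=> [e|Lxy].
  have : coset_mod L x x by rewrite /coset_mod /= subrr; exact: hL.1.
  by rewrite e.
apply/seteqP; split=> z Lz; rewrite /coset_mod /= in Lz *.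
  by rewrite -(subrKA x z); exact: latticeD.
by rewrite -(subrKA y z) -[y - x]opprB; apply: hL.2.
Qed.

Lemma toQ_image L x : (@toQ r @` L) (toQ x) <-> L x.
Proof. by split=> [[y Ly /toQ_inj <-]|Lx] //; exists x. Qed.

Lemma toQ_imageB L u v : lattice L -> (@toQ r @` L) u -> (@toQ r @` L) v ->
  (@toQ r @` L) (u - v).
Proof.
by move=> hL [x Lx <-] [y Ly <-]; exists (x - y); [exact: hL.2|rewrite toQB].
Qed.

Lemma toQ_imageN L u : lattice L -> (@toQ r @` L) u -> (@toQ r @` L) (- u).
Proof. by move=> hL [x Lx <-]; exists (- x); [exact: latticeN|rewrite toQN]. Qed.

Lemma toQ_imageNE L u : lattice L -> (@toQ r @` L) (- u) <-> (@toQ r @` L) u.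
Proof.
by move=> hL; split=> [/(toQ_imageN hL)|]; [rewrite opprK|exact: toQ_imageN].
Qed.

Lemma toQ_mul x w : toQ (x *m w) = toQ x *m map_mx intr w.
Proof. exact: map_mxM. Qed.

Lemma natural_map_coset L L' x : lattice L -> lattice L' -> L' `<=` L ->
  natural_map L (coset_mod L' x) = coset_mod L x.
Proof.
move=> hL hL' sub; apply/seteqP; split=> z /=.
  by move=> [y /sub Ly Lz]; rewrite /coset_mod /= -(subrKA y z); exact: latticeD.
by move=> Lz; exists x => //; rewrite /coset_mod /= subrr; exact: hL'.1.
Qed.

End Lattices.

Section TwistedAction.
Variables (r : nat) (D : root_datum r).
Implicit Types (L : set 'rV[int]_r) (x y z a : 'rV[int]_r) (w : 'M[int]_r).

Definition rho_pairing y a : rat := pairing (toQ y - rho D) (toQ a).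

Lemma rho_pairingD y z a : rho_pairing (y + z) a = rho_pairing y a + (pairing z a)%:~R.
Proof. by rewrite /rho_pairing toQD addrAC pairingDl pairing_toQ. Qed.

Lemma rho_pairingB x y a : (pairing (x - y) a)%:~R = rho_pairing x a - rho_pairing y a.
Proof. by rewrite -{2}(subrK y x) [x - y + y]addrC rho_pairingD addrAC subrr add0r. Qed.

(** If [v = y - rho], the twisted action of [w] sends [y + L] to
    [y + (v w - v) + L w], and [L w = L]. The image is read back in Y, so when
    [v w - v] is not integral it is empty, in accordance with the right-hand side. *)
Lemma twisted_set_fixedP L w w' y : lattice L -> stable L w -> stable L w' ->
  w' *m w = 1%:M ->
  twisted_set D w (coset_mod L y) = coset_mod L y <->
  (@toQ r @` L) ((toQ y - rho D) *m map_mx intr w - (toQ y - rho D)).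
Proof.
move=> hL Lw Lw' ww; set v := toQ y - rho D.
have tE y' : twisted D w (toQ y')
    = toQ ((y' - y) *m w + y) + (v *m map_mx intr w - v).
  rewrite /twisted toQD toQ_mul toQB /v !mulmxBl opprB.
  by rewrite addrACA subrKA [toQ y + _]addrC subrK.
split=> [e|[l Ll lE]].
  have : coset_mod L y y by rewrite /coset_mod /= subrr; exact: hL.1.
  rewrite -{1}e => -[_ [y' Ly' <-]]; rewrite tE => /(canRL (addKr _)) ->.
  exists (- ((y' - y) *m w)); first by apply: latticeN => //; exact: Lw.
  by rewrite toQN toQD opprD subrK.
apply/seteqP; split=> z.
  move=> [_ [y' Ly' <-]]; rewrite tE -lE -toQD => /toQ_inj <-.
  rewrite /coset_mod /= addrAC addrK.
  by apply: latticeD => //; exact: Lw.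
move=> Lz; exists (toQ (y + (z - y - l) *m w')).
  exists (y + (z - y - l) *m w') => //.
  by rewrite /coset_mod /= addrAC subrr add0r; apply: Lw'; exact: hL.2.
by rewrite tE -lE -toQD [y + _]addrC addrK -mulmxA ww mulmx1 addrAC !subrK.
Qed.

Lemma reflection_twist y a :
  (toQ y - rho D) *m map_mx intr (reflection D a) - (toQ y - rho D)
    = - (rho_pairing y a *: toQ (coroot D a)).
Proof.
rewrite /reflection map_mxB map_mx1 map_mxM -map_trmx mulmxBr mulmx1 mulmxA.
by rewrite mulmx_tr_pairing addrAC subrr sub0r.
Qed.

Lemma reflection_fixedP L y a : a \in roots D -> lattice L ->
  stable L (reflection D a) ->
  twisted_set D (reflection D a) (coset_mod L y) = coset_mod L y <->
  (@toQ r @` L) (rho_pairing y a *: toQ (coroot D a)).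
Proof.
move=> Ra hL Ls; rewrite (twisted_set_fixedP _ hL Ls Ls (reflectionK Ra)).
by rewrite reflection_twist; exact: toQ_imageNE.
Qed.

Lemma weyl_subgroup_fixedP L y a : a \in roots D -> lattice L ->
  stable L (reflection D a) ->
  (forall w, weyl_subgroup D a w ->
     twisted_set D w (coset_mod L y) = coset_mod L y) <->
  (@toQ r @` L) (rho_pairing y a *: toQ (coroot D a)).
Proof.
move=> Ra hL Ls; rewrite -reflection_fixedP //; split=> [h|h w].
  by apply: h; right.
case=> -> //; apply/(twisted_set_fixedP _ hL (w' := 1%:M)); rewrite ?mulmx1 //.
1,2: by move=> x; rewrite mulmx1.
by rewrite map_mx1 mulmx1 subrr; exists 0; [exact: hL.1|exact: toQ0].
Qed.

(** The displacement [w |-> (y - rho) w - (y - rho)] is a cocycle, so membership in a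
    W-stable lattice needs to be checked on the reflections only. *)
Lemma weyl_group_fixedP L y : lattice L ->
  {in roots D, forall a, stable L (reflection D a)} ->
  (forall w, weyl_group D w ->
     twisted_set D w (coset_mod L y) = coset_mod L y) <->
  {in roots D, forall a, (@toQ r @` L) (rho_pairing y a *: toQ (coroot D a))}.
Proof.
move=> hL Ls; split=> [h a Ra|h w [s sR ->]].
  apply/reflection_fixedP => //; first exact: Ls.
  apply: h; exists [:: a]; first by move=> x; rewrite inE => /eqP ->.
  by rewrite big_cons big_nil mulmx1.
have [w' [ww Lw Lw' fixw]] : exists w',
    let w := \big[mulmx/1%:M]_(a <- s) reflection D a in
    [/\ w' *m w = 1%:M, stable L w, stable L w' &
    (@toQ r @` L) ((toQ y - rho D) *m map_mx intr w - (toQ y - rho D))].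
  elim: s sR => [|a s IH] sR /=.
    exists 1%:M; rewrite big_nil mulmx1; split=> //.
    1,2: by move=> x; rewrite mulmx1.
    by rewrite map_mx1 mulmx1 subrr; exists 0; [exact: hL.1|exact: toQ0].
  have Ra : a \in roots D by apply: sR; rewrite mem_head.
  have [|w' [ww Lw Lw' [l Ll lE]]] := IH.
    by move=> x xs; apply: sR; rewrite inE xs orbT.
  exists (w' *m reflection D a); rewrite big_cons; split.
  - by rewrite mulmxA -(mulmxA w') reflectionK // mulmx1.
  - by move=> x Lx; rewrite mulmxA; apply: Lw; exact: Ls.
  - by move=> x Lx; rewrite mulmxA; apply: Ls => //; exact: Lw'.
  have [l' Ll' l'E] := (toQ_imageNE _ hL).2 (h a Ra).
  exists (l' *m \big[mulmx/1%:M]_(b <- s) reflection D b + l).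
    by apply: latticeD => //; exact: Lw.
  rewrite toQD toQ_mul l'E -reflection_twist lE map_mxM mulmxA mulmxBl.
  by rewrite addrA subrK.
exact/(twisted_set_fixedP _ hL Lw Lw' ww).
Qed.

Lemma twisted_fixed_image G L :
  twisted_fixed D G L = coset_mod L @`
    [set y | forall w, G w -> twisted_set D w (coset_mod L y) = coset_mod L y].
Proof.
apply/seteqP; split=> C; first by move=> [[y _ <-] h]; exists y.
by move=> [y h <-]; split=> //; exists y.
Qed.

End TwistedAction.

(** * Invariant quadratic forms and exceptional points *)

Section QuadraticForms.
Variables (r : nat) (Q : 'rV[int]_r -> int) (HQ : quadratic_form Q).
Implicit Types x y z : 'rV[int]_r.

Lemma polarC x y : polar Q x y = polar Q y x.
Proof. by rewrite /polar [x + y]addrC addrAC. Qed.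

Lemma polarDl x x' y : polar Q (x + x') y = polar Q x y + polar Q x' y.
Proof. exact: HQ.2. Qed.

Lemma polar0l y : polar Q 0 y = 0.
Proof. by apply: (addrI (polar Q 0 y)); rewrite -polarDl !addr0. Qed.

Lemma polarNl x y : polar Q (- x) y = - polar Q x y.
Proof. by apply/eqP; rewrite -addr_eq0 -polarDl addNr polar0l. Qed.

Lemma polarBl x x' y : polar Q (x - x') y = polar Q x y - polar Q x' y.
Proof. by rewrite polarDl polarNl. Qed.

Lemma polarZl k x y : polar Q (k *: x) y = k * polar Q x y.
Proof.
elim/int_ind: k => [|n IH|n IH]; first by rewrite scale0r mul0r polar0l.
  by rewrite intS scalerDl scale1r polarDl IH mulrDl mul1r.
by rewrite intS opprD scalerDl scaleN1r polarDl polarNl IH mulrDl mulN1r.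
Qed.

Lemma quadD x y : Q (x + y) = Q x + Q y + polar Q x y.
Proof. rewrite /polar; ring. Qed.

Lemma lattice_Y_Qn n : lattice (Y_Qn Q n).
Proof.
split=> [y|x y hx hy z]; first by rewrite polar0l.
by rewrite polarBl rpredB.
Qed.

Lemma Y_Qn_scale n x : Y_Qn Q n (n%:Z *: x).
Proof. by move=> y; rewrite polarZl dvdz_mulr. Qed.

Variables (D : root_datum r) (HW : weyl_invariant D Q).

(** Invariance of Q under the reflection in [a] reads
    [<y, a>^2 Q(a^vee) = <y, a> B(a^vee, y)], which settles the case [<y, a> != 0].
    Otherwise use this case for [y + a^vee] and for [a^vee]. *)
Lemma polar_coroot a y : a \in roots D ->
  polar Q (coroot D a) y = Q (coroot D a) * pairing y a.
Proof.
move=> Ra; set c := coroot D a.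
have ca : pairing c a = 2 := pairing_coroot Ra.
have base z : pairing z a != 0 -> polar Q c z = Q c * pairing z a.
  move=> z0; have : Q (z *m reflection D a) = Q z.
    apply: HW; exists [:: a]; first by move=> x; rewrite inE => /eqP ->.
    by rewrite big_cons big_nil mulmx1.
  rewrite reflection_mul -/c -scaleNr quadD (HQ.1) polarC polarZl.
  move=> e; apply: (mulfI z0); apply/eqP; rewrite -subr_eq0; apply/eqP.
  move: e; set p := pairing z a; set B := polar _ _ _; set q := Q c.
  move=> e; have {}e : (- p) ^+ 2 * q + - p * B = 0.
    by apply: (addrI (Q z)); rewrite addrA e addr0.
  rewrite -[RHS]oppr0 -e; ring.
have [y0|] := eqVneq (pairing y a) 0; last exact: base.
have h1 : polar Q c (y + c) = Q c * 2 by rewrite base pairingDl y0 ca.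
have h2 : polar Q c c = Q c * 2 by rewrite base ca.
move: h1; rewrite y0 mulr0 polarC polarDl h2 polarC -[RHS]add0r.
exact: addIr.
Qed.

Lemma polar_corootr a y : a \in roots D ->
  polar Q y (coroot D a) = Q (coroot D a) * pairing y a.
Proof. by rewrite polarC; exact: polar_coroot. Qed.

Lemma stable_Y_Qn n a : a \in roots D -> stable (Y_Qn Q n) (reflection D a).
Proof.
move=> Ra x hx y; rewrite reflection_mul polarBl polarZl polar_coroot //.
rewrite rpredB // mulrA dvdz_mulr // mulrC -polar_corootr //.
Qed.

Lemma quad_coroot_reflection a b g : a \in roots D ->
  coroot D b - pairing (coroot D b) a *: coroot D a = coroot D g ->
  Q (coroot D g) = Q (coroot D b).
Proof.
move=> Ra <-; rewrite -reflection_mul; apply: HW; exists [:: a].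
  by move=> x; rewrite inE => /eqP ->.
by rewrite big_cons big_nil mulmx1.
Qed.

Lemma lattice_Ysc_Qn n : lattice (Ysc_Qn D Q n).
Proof.
split; first by exists (fun=> 0); rewrite big1 // => a _; rewrite scale0r.
move=> _ _ [c ->] [c' ->]; exists (fun a => c a - c' a).
by rewrite -sumrB; apply: eq_bigr => a _; rewrite scalerBl.
Qed.

Lemma Ysc_Qn_coroot n a : a \in roots D ->
  Ysc_Qn D Q n (coroot D a *+ n_ D Q n a).
Proof.
move=> Ra; exists (fun b => (b == a)%:R).
rewrite (bigD1_seq a) ?fset_uniq //= eqxx scale1r big1 ?addr0 // => b /negbTE ->.
by rewrite scale0r.
Qed.

Lemma dvdn_n_mul n a : (n %| n_ D Q n a * `|Q (coroot D a)|)%N.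
Proof.
by rewrite divn_mulAC ?dvdn_gcdl // -muln_divA ?dvdn_gcdr // dvdn_mulr.
Qed.

Lemma Ysc_sub_Y_Qn n : Ysc_Qn D Q n `<=` Y_Qn Q n.
Proof.
move=> _ [c ->]; apply: (lattice_sum (lattice_Y_Qn n)).
move=> a Ra; apply: (latticeZ _ (lattice_Y_Qn n)).
move=> y; rewrite -scaler_nat polarZl polar_coroot // mulrA dvdz_mulr //.
by rewrite dvdzE abszM natz; exact: dvdn_n_mul.
Qed.

Lemma stable_Ysc_Qn n a : a \in roots D -> stable (Ysc_Qn D Q n) (reflection D a).
Proof.
move=> Ra _ [c ->]; rewrite mulmx_suml; apply: (lattice_sum (lattice_Ysc_Qn n)).
move=> b Rb; rewrite -scalemxAl; apply: (latticeZ _ (lattice_Ysc_Qn n)).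
rewrite -scaler_nat -scalemxAl reflection_mul.
have [g Rg gE] := reflection_coroot Ra Rb.
have -> : n_ D Q n b = n_ D Q n g by rewrite /n_ (quad_coroot_reflection Ra gE).
by rewrite gE scaler_nat; exact: Ysc_Qn_coroot.
Qed.

Lemma n_gt0 n a : (0 < n)%N -> (0 < n_ D Q n a)%N.
Proof.
move=> n0; rewrite divn_gt0 ?gcdn_gt0 ?n0 // dvdn_leq //; exact: dvdn_gcdl.
Qed.

(** [n] divides [B(d, a^vee) = Q(a^vee) <d, a>], and [Q(a^vee) / gcd(n, Q(a^vee))] is
    prime to [n_a]. So translating by Y_Qn moves [<y - rho, a>] by multiples of [n_a]
    only, which is why normality can be tested on a single representative. *)
Lemma n_dvd_pairing n a d : (0 < n)%N -> a \in roots D -> Y_Qn Q n d ->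
  ((n_ D Q n a)%:Z %| pairing d a)%Z.
Proof.
move=> n0 Ra /(_ (coroot D a)); rewrite polar_corootr // !dvdzE abszM /=.
rewrite /n_; set q := `|Q _|%N; set g := gcdn n q => h.
have g0 : (0 < g)%N by rewrite gcdn_gt0 n0.
have cop : coprime (n %/ g) (q %/ g).
  by rewrite /coprime -(eqn_pmul2r g0) muln_gcdl !divnK ?dvdn_gcdl ?dvdn_gcdr // mul1n.
rewrite -(Gauss_dvdr _ cop) -(dvdn_pmul2r g0) mulnAC !divnK ?dvdn_gcdl ?dvdn_gcdr //.
Qed.

(** A representative of the class fixed modulo Ysc_Qn differs from [y] by an element
    of Y_Qn; by [n_dvd_pairing] this changes the displacement by a multiple of
    [n_a a^vee], which lies in Ysc_Qn. *)
Lemma alpha_normalP n a y : (0 < n)%N -> a \in roots D ->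
  alpha_normal D Q n a y <->
  (@toQ r @` Ysc_Qn D Q n) (rho_pairing D y a *: toQ (coroot D a)).
Proof.
move=> n0 Ra; rewrite /alpha_normal /im_phi twisted_fixed_image.
have hL := lattice_Y_Qn n; have hS := lattice_Ysc_Qn n.
split.
  move=> [_ [x h <-]]; rewrite natural_map_coset //; last exact: Ysc_sub_Y_Qn.
  move=> /(coset_mod_eqP _ _ hL) /(n_dvd_pairing n0 Ra) /dvdzP [k kE].
  move/(weyl_subgroup_fixedP _ Ra hS (stable_Ysc_Qn Ra)): h => h.
  have -> : rho_pairing D y a *: toQ (coroot D a)
      = rho_pairing D x a *: toQ (coroot D a)
        - toQ (k *: (coroot D a *+ n_ D Q n a)).
    rewrite toQZ toQMn scalerA -scalerBl; congr (_ *: _).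
    have -> : rho_pairing D x a = rho_pairing D y a + (pairing (x - y) a)%:~R.
      by rewrite -rho_pairingD addrC subrK.
    by rewrite kE rmorphM /= -pmulrn addrK.
  apply: toQ_imageB => //; apply/toQ_image; apply: (latticeZ _ hS).
  exact: Ysc_Qn_coroot.
move=> h; exists (coset_mod (Ysc_Qn D Q n) y).
  exists y => //=; exact/(weyl_subgroup_fixedP _ Ra hS (stable_Ysc_Qn Ra)).
by rewrite natural_map_coset //; exact: Ysc_sub_Y_Qn.
Qed.

Lemma weyl_subgroup_fixed_Y_QnP n a y : a \in roots D ->
  twisted_fixed D (weyl_subgroup D a) (Y_Qn Q n) (coset_mod (Y_Qn Q n) y) <->
  (@toQ r @` Y_Qn Q n) (rho_pairing D y a *: toQ (coroot D a)).
Proof.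
move=> Ra; rewrite -(weyl_subgroup_fixedP _ Ra (lattice_Y_Qn n) (stable_Y_Qn Ra)).
by split=> [[_ h]|h] //; split=> //; exists y.
Qed.

Definition half_special n a :=
  (@toQ r @` (Y_Qn Q n `\` Ysc_Qn D Q n)) (((n_ D Q n a)%:R / 2) *: toQ (coroot D a)).

(** When [<y - rho, a> = - n_a] the displacement [n_a a^vee] lies in Ysc_Qn, so
    normality is automatic; in the special case the condition depends on [n] and [a]
    but no longer on [y]. *)
Lemma Y_excP n y : (0 < n)%N ->
  Y_exc D Q n y <-> {in simple_roots D, forall a,
     rho_pairing D y a = - (n_ D Q n a)%:R \/
     rho_pairing D y a = - ((n_ D Q n a)%:R / 2) /\ half_special n a}.
Proof.
move=> n0; rewrite /Y_exc /=.
have E a : a \in simple_roots D ->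
    (alpha_normal D Q n a y /\ rho_pairing D y a = - (n_ D Q n a)%:R \/
     alpha_special D Q n a y /\ rho_pairing D y a = - ((n_ D Q n a)%:R / 2)) <->
    (rho_pairing D y a = - (n_ D Q n a)%:R \/
     rho_pairing D y a = - ((n_ D Q n a)%:R / 2) /\ half_special n a).
  move=> /simple_sub Ra; rewrite alpha_normalP //.
  have hL := lattice_Y_Qn n; have hS := lattice_Ysc_Qn n.
  split=> [[[_ ->]|[[hY hN] tE]]|[tE|[tE [x [hY hN] xE]]]].
  - by left.
  - right; split=> //; move: hY => /(weyl_subgroup_fixed_Y_QnP _ _ Ra).
    rewrite tE scaleNr toQ_imageNE // => -[x hx xE]; exists x => //; split=> // hx'.
    apply: hN; apply/alpha_normalP => //; rewrite tE scaleNr toQ_imageNE // -xE.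
    exact/toQ_image.
  - left; split=> //; rewrite tE scaleNr toQ_imageNE // -toQMn; apply/toQ_image.
    exact: Ysc_Qn_coroot.
  - right; split=> //; split.
      apply/weyl_subgroup_fixed_Y_QnP => //; rewrite tE scaleNr toQ_imageNE //.
      by rewrite -xE; exact/toQ_image.
    move=> /(alpha_normalP _ n0 Ra); rewrite tE scaleNr toQ_imageNE // -xE.
    by rewrite toQ_image.
by split=> h a Da; have := h a Da; rewrite -/(rho_pairing D y a) => ?; apply/E.
Qed.

End QuadraticForms.

(** * Counting cosets *)

Section Counting.
Variable r : nat.
Implicit Types (L P : set 'rV[int]_r) (x y z : 'rV[int]_r).

Lemma finite_classes L n P : lattice L -> (0 < n)%N ->
  (forall x, L (n%:Z *: x)) -> finite_set (coset_mod L @` P).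
Proof.
move=> hL n0 Ln.
pose f (t : 'rV['I_n]_r) : 'rV[int]_r := map_mx (fun i : 'I_n => (val i)%:Z) t.
apply: (@sub_finite_set _ _ ((coset_mod L \o f) @` setT)); last first.
  by apply: finite_image; exact: finite_finset.
move=> _ [y _ <-]; pose c i := y 0 i.
exists (\row_i Ordinal (ltn_pmod `|(c i %% n)%Z|%N n0)) => //=.
apply/(coset_mod_eqP _ _ hL).
rewrite (_ : _ - y = n%:Z *: \row_i - (c i %/ n)%Z) //.
apply/rowP => i; rewrite !mxE /=.
have n0' : n%:Z != 0 by rewrite eqz_nat -lt0n.
rewrite modn_small; last by rewrite -ltz_nat gez0_abs ?modz_ge0 // ltz_pmod.
rewrite gez0_abs ?modz_ge0 // -/(c i) {2}(divz_eq (c i) n%:Z); ring.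
Qed.

(** Injectivity on classes is enough: choosing a representative in each class makes
    compatibility of [F] with the two congruences irrelevant. *)
Lemma card_classes_le L L' P P' (F : 'rV[int]_r -> 'rV[int]_r) :
  lattice L -> lattice L' ->
  finite_set (coset_mod L @` P) -> finite_set (coset_mod L' @` P') ->
  (forall y, P y -> P' (F y)) ->
  (forall x y, P x -> P y -> L' (F x - F y) -> L (x - y)) ->
  (#|` fset_set (coset_mod L @` P)| <= #|` fset_set (coset_mod L' @` P')|)%N.
Proof.
move=> hL hL' finP finP' PF Finj.
pose rep C := xget 0 [set y | P y /\ coset_mod L y = C].
have repP C : (coset_mod L @` P) C -> P (rep C) /\ coset_mod L (rep C) = C.
  move=> [y Py yC]; apply: (@xgetPex _ 0 [set y | P y /\ coset_mod L y = C]).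
  by exists y.
pose G C := coset_mod L' (F (rep C)).
have Ginj : {in fset_set (coset_mod L @` P) &, injective G}.
  move=> C C'; rewrite !in_fset_set // !inE => /repP [PC CE] /repP [PC' CE'].
  move/(coset_mod_eqP _ _ hL')/(Finj _ _ PC PC')/(coset_mod_eqP _ _ hL).
  by rewrite CE CE'.
have <- := card_in_imfset imfset_key Ginj.
apply: fsubset_leq_card; apply/fsubsetP => _ /imfsetP [C /= hC ->].
rewrite in_fset_set // inE; rewrite in_fset_set // inE in hC.
by exists (F (rep C)) => //; apply: PF; case: (repP _ hC).
Qed.

Lemma card_classes_gt0 L P : finite_set (coset_mod L @` P) ->
  (0 < #|` fset_set (coset_mod L @` P)|)%N <-> exists y, P y.
Proof.
move=> fin; rewrite cardfs_gt0; split=> [/fset0Pn [C]|[y Py]].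
  by rewrite in_fset_set // inE => -[y Py _]; exists y.
by apply/fset0Pn; exists (coset_mod L y); rewrite in_fset_set // inE; exists y.
Qed.

Lemma card_classes_ge L P z (J : nat) y : lattice L ->
  finite_set (coset_mod L @` P) ->
  (forall j : nat, P (y + j%:Z *: z)) ->
  (forall k : int, L (k *: z) -> `|k| < J%:Z -> k = 0) ->
  (J <= #|` fset_set (coset_mod L @` P)|)%N.
Proof.
move=> hL fin Pz Lz.
pose f (j : 'I_J) := coset_mod L (y + (val j)%:Z *: z).
have finj : injective f.
  move=> j j' /(coset_mod_eqP _ _ hL); rewrite [y + _]addrC addrKA -scalerBl => /Lz h.
  apply/val_inj/eqP; rewrite -eqz_nat -subr_eq0 h //.
  move: (ltn_ord j) (ltn_ord j') => /=.
  by move: (nat_of_ord j) (nat_of_ord j') => k k'; lia.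
have <- : size (map f (enum 'I_J)) = J by rewrite size_map -cardE card_ord.
apply: uniq_leq_size; first by rewrite map_inj_uniq ?enum_uniq.
move=> _ /mapP [j _ ->].
by rewrite in_fset_set // inE; exists (y + (val j)%:Z *: z).
Qed.

End Counting.

(** * Families of coset counts with a rescaling map *)

Section ClassCounts.
Variables (r : nat) (Q : 'rV[int]_r -> int) (HQ : quadratic_form Q).
Variables (P : nat -> set 'rV[int]_r) (K : set 'rV[int]_r) (c : nat).
Implicit Types x y z : 'rV[int]_r.

Definition class_count n := #|` fset_set (coset_mod (Y_Qn Q n) @` P n)|.

Hypothesis c_gt0 : (0 < c)%N.
Hypothesis transfer : forall (n m : nat) (j : int),
  (0 < n)%N -> (0 < m)%N -> m%:Z = n%:Z + j * c%:Z ->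
  exists F : 'rV[int]_r -> 'rV[int]_r,
    (forall y, P n y -> P m (F y)) /\
    (forall x y, P n x -> P n y -> K (n%:Z *: (F x - F y) - m%:Z *: (x - y))).
Hypothesis K_scale : forall (k : int) z, K z -> K (k *: z).
Hypothesis P_translate : forall n y z, (0 < n)%N -> P n y -> K z -> P n (y + z).

Lemma finite_Y_Qn_classes n A : (0 < n)%N -> finite_set (coset_mod (Y_Qn Q n) @` A).
Proof.
by move=> n0; apply: finite_classes n0 _; [exact: lattice_Y_Qn|exact: Y_Qn_scale].
Qed.

(** If [B(n (F x - F y) - m (x - y), .) = 0], then [F x = F y] modulo Y_Qm implies
    [x = y] modulo Y_Qn, so the count at [n] is at most the count at [m]. The
    hypothesis on [n] and [m] is symmetric because [j] may be negative, and the counts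
    agree. *)
Lemma purely_periodic_class_count :
  (forall z, K z -> forall y, polar Q z y = 0) -> purely_periodic class_count.
Proof.
move=> Krad.
have le n m j : (0 < n)%N -> (0 < m)%N -> m%:Z = n%:Z + j * c%:Z ->
    (class_count n <= class_count m)%N.
  move=> n0 m0 mE; have [F [PF FK]] := transfer n0 m0 mE.
  apply: (card_classes_le _ _ (finite_Y_Qn_classes _ n0)
    (finite_Y_Qn_classes _ m0) PF); try exact: lattice_Y_Qn.
  move=> x y Px Py mF z; have E := Krad _ (FK _ _ Px Py) z.
  rewrite (polarBl HQ) !(polarZl HQ) in E; move: E; have /dvdzP [e ->] := mF z => /eqP.
  have m0' : m%:Z != 0 by rewrite eqz_nat -lt0n.
  rewrite mulrA [_ * m%:Z]mulrC -mulrBr mulf_eq0 (negbTE m0') /= subr_eq0 => /eqP <-.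
  by rewrite dvdz_mulr.
exists c => // n n0; apply/eqP; rewrite eqn_leq.
by rewrite (@le _ _ 1) ?(@le _ _ (-1)) // ?addn_gt0 ?n0 //; lia.
Qed.

(** A multiple [k z] lies in Y_Qn only if [n] divides [k B(z, y0)], so about
    [n / |B(z, y0)|] translates of a point by multiples of [z] are incongruent. *)
Lemma class_count_growth z y0 n : (0 < n)%N -> K z -> polar Q z y0 != 0 ->
  (0 < class_count n)%N -> (n <= 2 * `|polar Q z y0| * class_count n)%N.
Proof.
move=> n0 Kz; set u := polar Q z y0 => u0 b0.
have /(card_classes_gt0 (finite_Y_Qn_classes _ n0)) [y Py] := b0.
have u0' : (0 < `|u|)%N by rewrite absz_gt0.
have : (n %/ `|u| <= class_count n)%N.
  apply: (@card_classes_ge _ _ _ z _ y); first exact: lattice_Y_Qn.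
  - exact: finite_Y_Qn_classes.
  - by move=> j; apply: P_translate => //; exact: K_scale.
  move=> k /(_ y0); rewrite (polarZl HQ) -/u => h kn; apply/eqP.
  rewrite -absz_eq0 -leqn0 leqNgt; apply/negP => k0.
  move: h; rewrite dvdzE abszM /= => /dvdn_leq; rewrite muln_gt0 k0 u0' => /(_ isT).
  rewrite leqNgt => /negP; apply.
  have kn' : (`|k| < n %/ `|u|)%N by lia.
  by apply: leq_trans (leq_trunc_div n `|u|); rewrite ltn_pmul2r.
have := ltn_ceil n u0'; move: (n %/ _)%N b0 => t; nia.
Qed.

(** Either K lies in the radical of B and the count is periodic, or the count grows
    linearly where it is nonzero and cannot be eventually periodic without vanishing. *)
Lemma class_count_cyclic_denominator :
  cyclic_denominator (poincare_series class_count) -> purely_periodic class_count.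
Proof.
have [Krad|] := pselect (forall z, K z -> forall y, polar Q z y = 0).
  by move=> _; exact: purely_periodic_class_count.
move/existsNP => [z] /not_implyP [Kz] /existsNP [y0 /eqP u0].
apply: (@eventually_periodic_purely _ c (2 * `|polar Q z y0|)) => // n n0.
  move=> /(card_classes_gt0 (finite_Y_Qn_classes _ n0)) [y Py].
  have nc0 : (0 < n + c)%N by rewrite addn_gt0 n0.
  have [|F [PF _]] := @transfer n (n + c) 1 n0 nc0; first by rewrite mul1r.
  apply/(card_classes_gt0 (finite_Y_Qn_classes _ nc0)).
  by exists (F y); exact: PF.
exact: class_count_growth.
Qed.

End ClassCounts.

(** * The radical of the polar form *)

Section SemisimpleRadical.
Variables (r : nat) (D : root_datum r) (Q : 'rV[int]_r -> int).
Hypotheses (HQ : quadratic_form Q) (HW : weyl_invariant D Q).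
Implicit Types (a y z : 'rV[int]_r).

(** The directions along which the displacement of a class does not change modulo
    Y_Qn, for every n: a coroot with [Q(a^vee) = 0] lies in the radical of B. *)
Definition weighted_kernel : set 'rV[int]_r :=
  [set z | {in roots D, forall a, Q (coroot D a) * pairing z a = 0}].

Definition simple_kernel : set 'rV[int]_r :=
  [set z | {in simple_roots D, forall a, pairing z a = 0}].

Lemma polar_row z : exists u, forall y, polar Q z y = pairing u y.
Proof.
exists (\row_i polar Q z (delta_mx 0 i)) => y.
rewrite polarC {1}(row_sum_delta y).
have -> : polar Q (\sum_j y 0 j *: delta_mx 0 j) z
    = \sum_j y 0 j * polar Q (delta_mx 0 j) z.
  elim/big_ind2: _ => [|x1 x2 y1 y2 <- <-|j _]; [exact: polar0l|exact: polarDl|].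
  exact: polarZl.
by apply: eq_bigr => j _; rewrite mxE mulrC polarC.
Qed.

(** The linear form [u = B(z, .)] vanishes on all coroots, since
    [B(z, a^vee) = Q(a^vee) <z, a>]. By semisimplicity a multiple of [u] is a
    combination of roots, and such a combination is 0 when it is orthogonal to the
    coroots. *)
Lemma semisimple_weighted_kernel : semisimple D ->
  forall z, weighted_kernel z -> forall y, polar Q z y = 0.
Proof.
move=> ss z Kz y; have [u uE] := polar_row z.
have [m m0 [c mE]] := ss u.
have Qu : toQ (m *: u) = \sum_(a <- roots D) (c a)%:~R *: toQ a.
  by rewrite mE toQ_sum; apply: eq_bigr => a _; rewrite toQZ.
have : toQ (m *: u) = 0.
  rewrite Qu; apply: root_span_orthogonal => a Ra.
  rewrite -Qu pairing_toQ pairingC pairingZl -uE polar_corootr //.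
  by rewrite Kz // mulr0.
rewrite -[RHS](toQ0 r) => /toQ_inj mu0.
by apply: (mulfI m0); rewrite mulr0 uE -pairingZl mu0 pairing0l.
Qed.

Lemma semisimple_simple_kernel : semisimple D ->
  forall z, simple_kernel z -> forall y, polar Q z y = 0.
Proof.
move=> ss z Kz y.
have Kr a : a \in roots D -> pairing z a = 0.
  move=> /simple_base [c]; have h : pairing (\sum_(d <- simple_roots D) d *+ c d) z = 0.
    rewrite pairing_suml big_seq big1 // => d Dd.
    by rewrite -scaler_nat pairingZl pairingC Kz // mulr0.
  by case=> ->; rewrite pairingC ?pairingNl h ?oppr0.
suff -> : z = 0 by exact: polar0l.
apply/rowP => i; rewrite mxE -(pairing_delta z).
have [m m0 [c mE]] := ss (delta_mx 0 i).
apply: (mulfI m0); rewrite mulr0 pairingC -pairingZl mE pairing_suml.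
rewrite big_seq big1 // => a Ra.
by rewrite pairingZl pairingC Kr // mulr0.
Qed.

End SemisimpleRadical.

(** * Rescaling of classes fixed by the Weyl group *)

Section WeylFixedClasses.
Variables (r : nat) (D : root_datum r) (Q : 'rV[int]_r -> int).
Hypotheses (HQ : quadratic_form Q) (HW : weyl_invariant D Q).
Implicit Types (a b y z t : 'rV[int]_r) (n m : nat).

Lemma polar_rational_coroot a t k y : a \in roots D ->
  toQ t = k *: toQ (coroot D a) ->
  (polar Q t y)%:~R = k * (Q (coroot D a))%:~R * (pairing y a)%:~R.
Proof.
move=> Ra tE; have d0 : (denq k)%:~R != 0 :> rat by rewrite intr_eq0 denq_eq0.
have : denq k *: t = numq k *: coroot D a.
  apply: toQ_inj; rewrite !toQZ tE scalerA; congr (_ *: _).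
  by rewrite mulrC -[X in X * _]divq_num_den divfK.
move/(congr1 (fun x => (polar Q x y)%:~R : rat)).
rewrite !(polarZl HQ) (polar_coroot HQ HW) // !rmorphM /= => h.
apply: (mulfI d0); rewrite {}h !mulrA; congr (_ * _ * _).
by rewrite mulrC -[X in X * _]divq_num_den divfK.
Qed.

(** The value [B(k a^vee, y) = k Q(a^vee) <y, a>] is multiplied by [m / n], so its
    divisibility by [n] becomes divisibility by [m]; integrality of [k a^vee] is kept
    because [k] moves by an integer. *)
Lemma toQ_Y_Qn_transfer n m a k k' (i : int) : (0 < n)%N -> a \in roots D ->
  k' = k + i%:~R ->
  n%:R * (k' * (Q (coroot D a))%:~R) = m%:R * (k * (Q (coroot D a))%:~R) ->
  (@toQ r @` Y_Qn Q n) (k *: toQ (coroot D a)) ->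
  (@toQ r @` Y_Qn Q m) (k' *: toQ (coroot D a)).
Proof.
move=> n0 Ra kE nm [t ht tE].
have tE' : toQ (t + i *: coroot D a) = k' *: toQ (coroot D a).
  by rewrite toQD toQZ tE kE scalerDl.
exists (t + i *: coroot D a) => // y; have /dvdzP [e eE] := ht y.
apply/dvdzP; exists e; apply: (@intr_inj rat).
have n0' : n%:R != 0 :> rat by rewrite pnatr_eq0 -lt0n.
apply: (mulfI n0'); rewrite (polar_rational_coroot _ Ra tE') mulrA nm.
rewrite -mulrA -(polar_rational_coroot _ Ra tE) eE !rmorphM /= -!pmulrn; ring.
Qed.

Definition weyl_solutions n : set 'rV[int]_r :=
  [set y | {in roots D, forall a,
     (@toQ r @` Y_Qn Q n) (rho_pairing D y a *: toQ (coroot D a))}].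

Lemma b_WE : b_W D Q = class_count Q weyl_solutions.
Proof.
apply/funext => n; have st := @stable_Y_Qn _ _ HQ _ HW n.
rewrite /b_W /class_count twisted_fixed_image.
congr (size (fset_set (_ @` _))); apply/seteqP; split=> y.
  by move=> /(weyl_group_fixedP _ (lattice_Y_Qn HQ n) st).
by move=> h; apply/(weyl_group_fixedP _ (lattice_Y_Qn HQ n) st).
Qed.

Lemma weyl_solutions_translate n y z : (0 < n)%N ->
  weyl_solutions n y -> weighted_kernel D Q z -> weyl_solutions n (y + z).
Proof.
move=> n0 hy hz a Ra; apply: (toQ_Y_Qn_transfer n0 Ra _ _ (hy a Ra)).
  exact: rho_pairingD.
rewrite rho_pairingD mulrDl; congr (_ * _).
by rewrite -rmorphM mulrC /= [_ * Q _]mulrC hz // addr0 mulrC.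
Qed.

(** Let [A] be the matrix of the linear forms [Q(a^vee) a], let [P] be a rational
    pseudo-inverse of it, so that [A P A = A], and [v = y - rho]. The solution is
    [y' = y + ((m - n) / n) v A P], since
    [(y' - rho) A = v A + ((m - n) / n) v A = (m / n) v A]. The entries of [2 v A / n]
    are integers, so [y'] is integral once [m - n] is divisible by twice a denominator
    of [P], a bound independent of [n] and [y]. *)
Lemma weyl_solutions_rescale : exists2 c : nat, (0 < c)%N &
  forall n m (j : int), (0 < n)%N -> (0 < m)%N -> m%:Z = n%:Z + j * c%:Z ->
  forall y, weyl_solutions n y -> exists y', {in roots D, forall a,
    n%:R * (rho_pairing D y' a * (Q (coroot D a))%:~R)
      = m%:R * (rho_pairing D y a * (Q (coroot D a))%:~R)}.
Proof.
pose s : seq 'rV[int]_r := roots D; pose N := size s.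
pose A : 'M[rat]_(r, N) :=
  \matrix_(i, k) (toQ s`_k 0 i * (Q (coroot D s`_k))%:~R).
have [c0 c00 [P0 PE]] := common_denominator (pinvmx A).
(* The factor 2 is <a^vee, a>: testing membership in Y_Qn against a^vee gives
   integrality of 2 <y - rho, a> Q(a^vee) / n. *)
exists (2 * c0)%N; first by rewrite muln_gt0.
move=> n m j n0 m0 mE y hy.
have n0' : n%:R != 0 :> rat by rewrite pnatr_eq0 -lt0n.
have vA x k : ((toQ x - rho D) *m A) 0 k
    = rho_pairing D x s`_k * (Q (coroot D s`_k))%:~R.
  rewrite mxE /rho_pairing /pairing mulr_suml; apply: eq_bigr => i _.
  by rewrite [A _ _]mxE mulrA.
have [e eE] : exists e : 'rV[int]_N,
    n%:R *: toQ e = 2 *: ((toQ y - rho D) *m A).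
  have h (k : 'I_N) : exists e : int, n%:R * e%:~R
      = 2 * (rho_pairing D y s`_k * (Q (coroot D s`_k))%:~R) :> rat.
    have Rk : s`_k \in roots D by apply: mem_nth.
    have [t ht tE] := hy _ Rk; have /dvdzP [e eE] := ht (coroot D s`_k).
    exists e; have := polar_rational_coroot (coroot D s`_k) Rk tE.
    rewrite pairing_coroot // eE rmorphM /= -pmulrn mulrC => ->.
    by rewrite mulrC.
  have [f fE] := choice h.
  by exists (\row_k f k); apply/rowP => k; rewrite mxE [RHS]mxE vA -fE !mxE.
exists (y + j *: (e *m P0)) => a Ra.
have ak : (index a s < N)%N by rewrite index_mem.
have := vA (y + j *: (e *m P0)) (Ordinal ak).
have := vA y (Ordinal ak); rewrite /= nth_index // => <- <-.
have -> : (toQ (y + j *: (e *m P0)) - rho D) *m A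
    = (1 + j%:~R * c0%:R * (2 / n%:R)) *: ((toQ y - rho D) *m A).
  rewrite toQD addrAC mulmxDl toQZ /toQ map_mxM -PE -/(toQ e) -/(toQ y).
  rewrite scalerDl scale1r; congr (_ + _).
  have -> : toQ e = (2 / n%:R) *: ((toQ y - rho D) *m A).
    by rewrite mulrC -scalerA -eE scalerA mulVf // scale1r.
  rewrite -!scalemxAl -!scalemxAr -!scalemxAl mulmxKpV ?submxMl //.
  by rewrite !scalerA mulrAC.
rewrite [in LHS]mxE mulrA; congr (_ * _).
have -> : m%:R = n%:R + j%:~R * (2 * c0%:R) :> rat.
  have /(congr1 (fun x : int => x%:~R : rat)) := mE.
  by rewrite rmorphD rmorphM /= -!pmulrn natrM.
by field.
Qed.

Lemma weyl_solutions_transfer : exists2 c : nat, (0 < c)%N &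
  forall n m (j : int), (0 < n)%N -> (0 < m)%N -> m%:Z = n%:Z + j * c%:Z ->
  exists F : 'rV[int]_r -> 'rV[int]_r,
    (forall y, weyl_solutions n y -> weyl_solutions m (F y)) /\
    (forall x y, weyl_solutions n x -> weyl_solutions n y ->
       weighted_kernel D Q (n%:Z *: (F x - F y) - m%:Z *: (x - y))).
Proof.
have [c c0 cE] := weyl_solutions_rescale; exists c => // n m j n0 m0 mE.
have /choice [F FE] : forall y, exists y', weyl_solutions n y ->
    {in roots D, forall a, n%:R * (rho_pairing D y' a * (Q (coroot D a))%:~R)
      = m%:R * (rho_pairing D y a * (Q (coroot D a))%:~R)}.
  move=> y; have [hy|hy] := pselect (weyl_solutions n y); last by exists 0.
  by have [y' y'E] := cE _ _ _ n0 m0 mE _ hy; exists y'.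
exists F; split=> [y hy a Ra|x y hx hy a Ra].
  apply: (toQ_Y_Qn_transfer (i := pairing (F y - y) a) n0 Ra _ (FE y hy a Ra)
    (hy a Ra)).
  by rewrite -rho_pairingD addrC subrK.
apply: (@intr_inj rat); rewrite pairingBl !pairingZl rmorphM rmorphB !rmorphM /=.
rewrite !(rho_pairingB D) -!pmulrn.
have := FE x hx a Ra; have := FE y hy a Ra.
move: (rho_pairing D x a) (rho_pairing D y a) => A1 A2.
move: (rho_pairing D (F x) a) (rho_pairing D (F y) a) => A3 A4.
set q := (Q (coroot D a))%:~R => e1 e2.
transitivity (n%:R * (A3 * q) - n%:R * (A4 * q)
  - (m%:R * (A1 * q) - m%:R * (A2 * q))); first by ring.
by rewrite e1 e2 subrr.
Qed.

End WeylFixedClasses.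

(** * Rescaling of exceptional points *)

Section Exceptional.
Variables (r : nat) (D : root_datum r) (Q : 'rV[int]_r -> int).
Hypotheses (HQ : quadratic_form Q) (HW : weyl_invariant D Q).
Implicit Types (a b y z t : 'rV[int]_r) (n m : nat).

(** Integral multiples of a rational right inverse of the matrix of simple roots,
    which has full rank. *)
Lemma simple_roots_dual : exists2 c : nat, (0 < c)%N &
  exists e : 'rV[int]_r -> 'rV[int]_r, {in simple_roots D &, forall a b,
    pairing (e a) b = c%:Z * (a == b)%:R}.
Proof.
pose s : seq 'rV[int]_r := simple_roots D; pose l := size s.
have us : uniq s by exact: fset_uniq.
pose A : 'M[rat]_(l, r) := \matrix_(i < l) toQ s`_i.
have freeA : row_free A.
  apply: inj_row_free => v vA.
  have [c c0 [v0 vE]] := common_denominator v.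
  pose k d : int := if insub (index d s) is Some i then v0 0 i else 0.
  have k0 : {in simple_roots D, forall d, k d = 0}.
    apply: simple_free; apply: toQ_inj; rewrite toQ0 toQ_sum.
    transitivity ((c%:R *: v) *m A); last by rewrite -scalemxAl vA scaler0.
    rewrite -/s vE mulmx_sum_row (big_nth 0) big_mkord; apply: eq_bigr => i _.
    rewrite rowK toQZ mxE /k index_uniq ?ltn_ord // insubT ?ltn_ord // => h.
    by congr ((v0 0 _)%:~R *: _); apply/val_inj.
  apply/rowP => i; rewrite mxE.
  have := k0 s`_i (mem_nth _ (ltn_ord i)).
  rewrite /k index_uniq ?ltn_ord // insubT ?ltn_ord // => h hv.
  have /rowP /(_ i) := vE; rewrite !mxE.
  have -> : v0 0 i = 0 by rewrite -hv; congr (v0 0 _); apply/val_inj.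
  by move/eqP; rewrite mulf_eq0 pnatr_eq0 -leqn0 leqNgt c0 /= => /eqP.
have [c c0 [P0 PE]] := common_denominator (pinvmx A).
exists c => //.
pose e a : 'rV[int]_r := if insub (index a s) is Some i then (col i P0)^T else 0.
exists e => a b Da Db.
have ai : (index a s < l)%N by rewrite index_mem.
have bi : (index b s < l)%N by rewrite index_mem.
apply: (@intr_inj rat); rewrite /e insubT -pairing_toQ.
transitivity ((c%:R *: (A *m pinvmx A)) (Ordinal bi) (Ordinal ai)).
  rewrite scalemxAr PE mxE /pairing; apply: eq_bigr => i _.
  by rewrite !mxE mulrC nth_index.
rewrite mulmxVp // !mxE rmorphM /= -pmulrn; congr (_ * _).
rewrite -val_eqE /= eq_sym rmorph_nat; congr (_%:R); congr nat_of_bool.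
by apply/eqP/eqP => [|->] // /(congr1 (nth 0 s)); rewrite !nth_index.
Qed.

(** [Q(a^vee) = 0] makes [n_a = 1] for every [n], while for the other roots [n_a]
    grows like [n]; the two kinds of roots have to be separated. *)
Definition same_kind a b :=
  (Q (coroot D a) == 0) == (Q (coroot D b) == 0).

(** Evaluate [B(a^vee, b^vee)] in two ways, as [Q(a^vee) <b^vee, a>] and as
    [Q(b^vee) <a^vee, b>]. *)
Lemma pairing_coroot_kind a b : a \in roots D -> b \in roots D ->
  ~~ same_kind a b -> pairing (coroot D a) b = 0.
Proof.
move=> Ra Rb.
have E : Q (coroot D a) * pairing (coroot D b) a
    = Q (coroot D b) * pairing (coroot D a) b.
  by rewrite -(polar_coroot HQ HW) // -(polar_corootr HQ HW).
rewrite /same_kind; have [qa|qa] := eqVneq (Q (coroot D a)) 0;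
  have [qb|qb] := eqVneq (Q (coroot D b)) 0 => // _.
  by move/esym/eqP: E; rewrite qa mul0r mulf_eq0 (negbTE qb) => /eqP.
apply: pairing_coroot_sym0 => //.
by move/eqP: E; rewrite qb mul0r mulf_eq0 (negbTE qa) => /eqP.
Qed.

Definition proportional n m := {in roots D, forall a,
  if Q (coroot D a) == 0 then n_ D Q n a = 1%N /\ n_ D Q m a = 1%N
  else (n_ D Q m a * n = n_ D Q n a * m)%N}.

(** In an expression of [(n_a / 2) a^vee] in Ysc_Qn, the coroots of the other kind than
    [a] contribute a vector [v] orthogonal to all roots: to those of the kind of [a]
    term by term, and to the others because [v] is also [(n_a / 2) a^vee] minus a
    combination of coroots of the kind of [a]. Hence [v = 0], and the remaining terms
    all scale by [m_a / n_a] when [n] is replaced by [m]. *)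
Lemma half_Ysc_transfer n m a : (0 < n)%N -> (0 < m)%N ->
  proportional n m -> a \in roots D ->
  (@toQ r @` Ysc_Qn D Q n) (((n_ D Q n a)%:R / 2) *: toQ (coroot D a)) ->
  (@toQ r @` Ysc_Qn D Q m) (((n_ D Q m a)%:R / 2) *: toQ (coroot D a)).
Proof.
move=> n0 m0 prop Ra [_ [c ->] cE].
pose cc b : rat := (c b)%:~R * (n_ D Q n b)%:R.
have {}cE : \sum_(b <- roots D) cc b *: toQ (coroot D b)
    = ((n_ D Q n a)%:R / 2) *: toQ (coroot D a).
  by rewrite -cE toQ_sum; apply: eq_bigr => b _; rewrite toQZ toQMn scalerA.
pose u := \sum_(b <- roots D) (if same_kind b a then cc b else 0) *: toQ (coroot D b).
pose v := \sum_(b <- roots D) (if same_kind b a then 0 else cc b) *: toQ (coroot D b).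
have uv : u + v = ((n_ D Q n a)%:R / 2) *: toQ (coroot D a).
  rewrite -cE -big_split; apply: eq_bigr => b _ /=.
  by case: ifP; rewrite scale0r ?addr0 ?add0r.
have v0 : v = 0.
  apply: coroot_span_orthogonal => g Rg; rewrite -/v.
  have orth b : b \in roots D -> ~~ same_kind b g ->
      pairing (toQ (coroot D b)) (toQ g) = 0.
    by move=> Rb bg; rewrite pairing_toQ pairing_coroot_kind.
  have [ga|ga] := boolP (same_kind g a).
    rewrite pairing_suml big_seq big1 // => b Rb; rewrite pairingZl.
    case: ifP => [_|/negbT ba]; first by rewrite mul0r.
    rewrite orth ?mulr0 //; apply: contra ba => /eqP h.
    by rewrite /same_kind h.
  have -> : v = ((n_ D Q n a)%:R / 2) *: toQ (coroot D a) - u.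
    by rewrite -uv addrAC subrr add0r.
  rewrite pairingBl pairingZl orth //; last by rewrite /same_kind eq_sym.
  rewrite mulr0 sub0r pairing_suml big_seq big1 ?oppr0 // => b Rb.
  rewrite pairingZl; case: ifP => [ba|_]; last by rewrite mul0r.
  rewrite orth ?mulr0 //; apply: contra ga => /eqP h.
  by move: ba; rewrite /same_kind h.
have na0 : (n_ D Q n a)%:R != 0 :> rat by rewrite pnatr_eq0 -lt0n n_gt0.
have n0' : n%:R != 0 :> rat by rewrite pnatr_eq0 -lt0n.
pose mu : rat := (n_ D Q m a)%:R / (n_ D Q n a)%:R.
have muE b : b \in roots D -> same_kind b a ->
    (n_ D Q m b)%:R = mu * (n_ D Q n b)%:R.
  move=> Rb; rewrite /same_kind /mu; have := prop b Rb; have := prop a Ra.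
  case: eqP => _; case: eqP => // _.
    by move=> [-> ->] [-> ->] _; rewrite invr1 !mulr1.
  move=> /(congr1 (fun k : nat => k%:R : rat)) ha.
  move=> /(congr1 (fun k : nat => k%:R : rat)) hb _.
  move: ha hb; rewrite !natrM => ha hb; apply: (mulIf na0).
  rewrite mulrAC divfK //; apply: (mulIf n0').
  by rewrite mulrAC hb [X in _ = X * _]mulrC -!mulrA ha [_ * m%:R]mulrC.
exists (\sum_(b <- roots D)
  (if same_kind b a then c b else 0) *: (coroot D b *+ n_ D Q m b)).
  by exists (fun b => if same_kind b a then c b else 0).
transitivity (mu *: u).
  rewrite toQ_sum scaler_sumr !big_seq; apply: eq_bigr => b Rb.
  rewrite toQZ toQMn !scalerA; congr (_ *: _).
  by case: ifP => ba; [rewrite muE // /cc; ring|rewrite mul0r mulr0].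
rewrite -[u]addr0 -v0 uv scalerA; congr (_ *: _).
by rewrite /mu mulrA divfK.
Qed.

Lemma half_special_transfer n m a (i : int) : (0 < n)%N -> (0 < m)%N ->
  proportional n m -> a \in roots D ->
  (n_ D Q m a)%:Z = (n_ D Q n a)%:Z + 2 * i ->
  half_special Q D n a -> half_special Q D m a.
Proof.
move=> n0 m0 prop Ra iE [x [hx xN] xE].
have iE' : (n_ D Q m a)%:R = (n_ D Q n a)%:R + 2 * i%:~R :> rat.
  have /(congr1 (fun k : int => k%:~R : rat)) := iE.
  by rewrite rmorphD rmorphM /= -!pmulrn.
have : (@toQ r @` Y_Qn Q m) (((n_ D Q m a)%:R / 2) *: toQ (coroot D a)).
  apply: (@toQ_Y_Qn_transfer _ _ _ HQ HW n m a ((n_ D Q n a)%:R / 2) _ i) => //.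
  - by rewrite iE'; field.
  - have := prop a Ra; case: eqP => [-> _|_]; first by rewrite !mulr0.
    move=> /(congr1 (fun k : nat => k%:R : rat)); rewrite !natrM => h.
    transitivity ((n_ D Q m a)%:R * n%:R * ((Q (coroot D a))%:~R / 2) : rat).
      by field.
    by rewrite h; field.
  - by exists x.
move=> [t ht tE]; exists t => //; split=> // hS; apply: xN.
have propC : proportional m n.
  move=> b Rb; have := prop b Rb; case: ifP => _; first by case.
  by move=> ->.
have : (@toQ r @` Ysc_Qn D Q n) (((n_ D Q n a)%:R / 2) *: toQ (coroot D a)).
  by apply: (half_Ysc_transfer m0 n0 propC Ra); exists t.
by rewrite -xE => /toQ_image.
Qed.

(** A common multiple of the nonzero [Q(a^vee)]: adding it to [n] does not change
    [gcd(n, Q(a^vee))]. *)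
Definition coroot_modulus : nat :=
  (\prod_(a <- roots D) (if Q (coroot D a) == 0 then 1 else `|Q (coroot D a)|))%N.

Lemma coroot_modulus_gt0 : (0 < coroot_modulus)%N.
Proof.
apply: prodn_cond_gt0 => a _; case: ifP => // /negbT; by rewrite absz_gt0.
Qed.

(** Since [gcd(n, Q(a^vee))] does not change, [n_a] changes by [m - n] divided by this
    gcd. *)
Lemma n_shift n m a c (j : int) : (0 < n)%N -> (0 < m)%N -> a \in roots D ->
  m%:Z = n%:Z + j * (c * coroot_modulus)%:Z ->
  exists2 h : int, (n_ D Q m a)%:Z = (n_ D Q n a)%:Z + h * c%:Z &
    if Q (coroot D a) == 0 then n_ D Q n a = 1%N /\ n_ D Q m a = 1%N
    else (n_ D Q m a * n = n_ D Q n a * m)%N.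
Proof.
move=> n0 m0 Ra mE; have [q0|q0] := eqVneq (Q (coroot D a)) 0.
  by exists 0; rewrite /n_ q0 !gcdn0 !divnn n0 m0 // mul0r.
rewrite /n_; set q := `|Q (coroot D a)|%N.
have [k kE] : exists k : nat, coroot_modulus = (k * q)%N.
  rewrite /coroot_modulus (big_rem a Ra) /= (negbTE q0) mulnC.
  by eexists; reflexivity.
set g := gcdn n q.
have gE : gcdn m q = g.
  have : gcdz m q = gcdz n q.
    rewrite mE kE !PoszM !mulrA gcdzC addrC gcdzMDl gcdzC //.
  by rewrite /gcdz /= => -[].
rewrite gE.
have g0 : (0 < g)%N by rewrite gcdn_gt0 n0.
have gn : (g %| n)%N := dvdn_gcdl _ _.
have gm : (g %| m)%N by rewrite -gE dvdn_gcdl.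
exists (j * k%:Z * (q %/ g)%N%:Z); last first.
  by rewrite mulnC !divn_mulAC // muln_divA // mulnC.
have g0' : g%:Z != 0 by rewrite eqz_nat -lt0n.
apply: (mulIf g0'); rewrite mulrDl -!PoszM !divnK // mE; congr (_ + _).
have qE : q%:Z = (q %/ g)%N%:Z * g%:Z by rewrite -PoszM divnK ?dvdn_gcdr.
rewrite kE !PoszM qE; ring.
Qed.

Lemma Y_exc_translate n y z : (0 < n)%N ->
  Y_exc D Q n y -> simple_kernel D z -> Y_exc D Q n (y + z).
Proof.
move=> n0 /(Y_excP HQ HW _ n0) hy hz; apply/(Y_excP HQ HW _ n0) => a Da.
by rewrite rho_pairingD hz // addr0; exact: hy.
Qed.

(** The point [F y] is obtained from [y] by moving each [<y - rho, a>] to its multiple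
    by [m_a / n_a], along the dual basis of the simple roots. The difference [m_a - n_a]
    has to be divisible by [2 c0]: by [c0], the denominator of the dual basis, and by 2
    for the values [- n_a / 2]. *)
Lemma Y_exc_transfer : exists2 c : nat, (0 < c)%N &
  forall n m (j : int), (0 < n)%N -> (0 < m)%N -> m%:Z = n%:Z + j * c%:Z ->
  exists F : 'rV[int]_r -> 'rV[int]_r,
    (forall y, Y_exc D Q n y -> Y_exc D Q m (F y)) /\
    (forall x y, Y_exc D Q n x -> Y_exc D Q n y ->
       simple_kernel D (n%:Z *: (F x - F y) - m%:Z *: (x - y))).
Proof.
have [c0 c00 [e eE]] := simple_roots_dual.
exists (2 * c0 * coroot_modulus)%N; first by rewrite !muln_gt0 c00 coroot_modulus_gt0.
move=> n m j n0 m0 mE.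
have shift a (Ra : a \in roots D) := n_shift n0 m0 Ra mE.
have prop : proportional n m by move=> a /shift [].
have na0 a : (n_ D Q n a)%:R != 0 :> rat by rewrite pnatr_eq0 -lt0n n_gt0.
have /choice [w wE] : forall p : 'rV[int]_r * 'rV[int]_r, exists k : int,
    Y_exc D Q n p.1 -> p.2 \in simple_roots D ->
    (n_ D Q n p.2)%:R * (rho_pairing D p.1 p.2 + (k * c0%:Z)%:~R)
      = (n_ D Q m p.2)%:R * rho_pairing D p.1 p.2.
  move=> [y a] /=; have [Da|] := boolP (a \in simple_roots D); last by exists 0.
  have [hy|] := pselect (Y_exc D Q n y); last by exists 0.
  have [h hE _] := shift a (simple_sub Da).
  have {}hE : (n_ D Q m a)%:R = (n_ D Q n a)%:R + h%:~R * (2 * c0%:R) :> rat.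
    have /(congr1 (fun k : int => k%:~R : rat)) := hE.
    by rewrite rmorphD rmorphM /= -!pmulrn natrM.
  have /(Y_excP HQ HW _ n0) /(_ a Da) [tE|[tE _]] := hy.
    exists (- (2 * h)) => _ _.
    rewrite tE hE !rmorphM /= rmorphN rmorphM /= -pmulrn; ring.
  exists (- h) => _ _; rewrite tE hE !rmorphM /= rmorphN /= -pmulrn; by field.
pose F y := y + \sum_(a <- simple_roots D) w (y, a) *: e a.
have FE y a : Y_exc D Q n y -> a \in simple_roots D ->
    (n_ D Q n a)%:R * rho_pairing D (F y) a = (n_ D Q m a)%:R * rho_pairing D y a.
  move=> hy Da; rewrite -(wE (y, a)) // rho_pairingD pairing_suml.
  congr (_ * (_ + _%:~R)).
  rewrite (bigD1_seq a) ?fset_uniq //= pairingZl eE // eqxx mulr1.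
  rewrite big_seq_cond big1 ?addr0 // => b /andP [Db /negbTE ba].
  by rewrite pairingZl eE // ba !mulr0.
exists F; split=> [y hy|x y hx hy a Da].
  apply/(Y_excP HQ HW _ m0) => a Da; have Ra := simple_sub Da.
  have := FE y a hy Da.
  have /(Y_excP HQ HW _ n0) /(_ a Da) [tE|[tE hs]] := hy; rewrite tE => h.
    by left; apply: (mulfI (na0 a)); rewrite h; ring.
  right; split; first by apply: (mulfI (na0 a)); rewrite h; field.
  have [k kE _] := shift a Ra.
  apply: (half_special_transfer (i := k * c0%:Z) n0 m0 prop Ra _ hs).
  by rewrite kE PoszM; ring.
apply: (@intr_inj rat); rewrite pairingBl !pairingZl rmorphB !rmorphM /=.
rewrite -!pmulrn !(rho_pairingB D).
have := FE x a hx Da; have := FE y a hy Da.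
have := prop a (simple_sub Da); case: eqP => [_ [n1 m1]|_].
  rewrite n1 m1 !mul1r => -> ->.
  (* Here the two values of <. - rho, a> lie in {-1, -1/2}; their difference is an
     integer, hence 0. *)
  have dE := rho_pairingB D x y a.
  suff : pairing (x - y) a = 0 by move=> d0; rewrite -dE d0 !mulr0 subrr.
  have /(Y_excP HQ HW _ n0) /(_ a Da) := hx; have /(Y_excP HQ HW _ n0) /(_ a Da) := hy.
  rewrite n1; move: (pairing _ _) dE => d dE hy' hx'.
  have lt1 : - 1 < (d%:~R : rat) < 1.
    rewrite dE; case: hy' => [->|[-> _]]; case: hx' => [->|[-> _]];
      by apply/andP; split; lra.
  case/andP: lt1 => d1 d2.
  have {d1} : (- 1 : int) < d by rewrite -(ltr_int rat) rmorphN.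
  have {d2} : d < (1 : int) by rewrite -(ltr_int rat).
  by move: (d : int) => d'; lia.
move=> /(congr1 (fun k : nat => k%:R : rat)); rewrite !natrM => nm.
move: (rho_pairing D x a) (rho_pairing D y a) => A1 A2.
move: (rho_pairing D (F x) a) (rho_pairing D (F y) a) => A3 A4 e1 e2.
apply: (mulfI (na0 a)); rewrite mulr0.
transitivity (n%:R * ((n_ D Q n a)%:R * A3 - (n_ D Q n a)%:R * A4)
  - (n_ D Q n a)%:R * m%:R * (A1 - A2)); first by ring.
by rewrite e1 e2 -nm; ring.
Qed.

End Exceptional.

(** * Periodicity and rationality of both series *)

Theorem corollary6p5 (r : nat) (D : root_datum r) (Q : 'rV[int]_r -> int)
    (HQ : quadratic_form Q) (HW : weyl_invariant D Q) :
  let bW := fun n : nat => b_W D Q n in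
  let bexc := fun n : nat => b_exc D Q n in
  let PW := poincare_series bW in
  let Pexc := poincare_series bexc in
  [/\ (purely_periodic bW <-> cyclic_denominator PW),
      (cyclic_denominator PW -> rational_series PW) &
      (almost_simple D -> purely_periodic bW /\ cyclic_denominator PW)] /\
  [/\ (purely_periodic bexc <-> cyclic_denominator Pexc),
      (cyclic_denominator Pexc -> rational_series Pexc) &
      (almost_simple D -> purely_periodic bexc /\ cyclic_denominator Pexc)].
Proof.
move=> bW bexc PW Pexc.
have assemble (b : nat -> nat) :
    (cyclic_denominator (poincare_series b) -> purely_periodic b) ->
    (almost_simple D -> purely_periodic b) ->
    [/\ purely_periodic b <-> cyclic_denominator (poincare_series b),
      cyclic_denominator (poincare_series b) -> rational_series (poincare_series b) &
      almost_simple D -> purely_periodic b /\ cyclic_denominator (poincare_series b)].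
  move=> hb hs; split.
  - by split=> //; exact: purely_periodic_cyclic_denominator.
  - exact: cyclic_denominator_rational.
  - by move=> /hs pb; split=> //; exact: purely_periodic_cyclic_denominator.
split; apply: assemble.
- have -> : bW = class_count Q (weyl_solutions D Q) by exact: b_WE.
  have [c c0 transfer] := weyl_solutions_transfer HQ HW.
  apply: (class_count_cyclic_denominator HQ c0 transfer).
    by move=> k z Kz a Ra; rewrite pairingZl mulrCA Kz // mulr0.
  by move=> n y z n0; exact: weyl_solutions_translate.
- move=> [ss _]; have -> : bW = class_count Q (weyl_solutions D Q) by exact: b_WE.
  have [c c0 transfer] := weyl_solutions_transfer HQ HW.
  apply: (purely_periodic_class_count HQ c0 transfer).
  exact: semisimple_weighted_kernel.
- have [c c0 transfer] := Y_exc_transfer HQ HW.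
  apply: (class_count_cyclic_denominator HQ c0 transfer).
    by move=> k z Kz a Ra; rewrite pairingZl Kz // mulr0.
  by move=> n y z n0; exact: Y_exc_translate.
- move=> [ss _]; have [c c0 transfer] := Y_exc_transfer HQ HW.
  apply: (purely_periodic_class_count HQ c0 transfer).
  exact: semisimple_simple_kernel.
Qed.
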